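(* Let $\mathbb{X}$ be a real Hilbert space and $\mathsf{E}\in C^1(\mathbb{X};\mathbb{R})$. Suppose that $\mathsf{E}$ satisfies the Palais--Smale condition (PS) on $\mathbb{X}$, and let $\{\mathbb{X}_N\}_{N\ge 0}$ be the sequence of finite-dimensional subspaces of $\mathbb{X}$ generated by running the adaptive local minimax Galerkin (LMMG) algorithm (described in the context) with $\epsilon_{\mathrm{tol}}=0$. For every $N\ge 0$ consider the closed subspace $L_N=\mathrm{span}\{w_{N,1},\dots,w_{N,n-1}\}\subset\mathbb{X}_N$ from the algorithm, and assume that the peak selection $p_N$ of $\mathsf{E}$ with respect to $L_N$ (on $\mathbb{X}_N$) fulfils the following properties: (a) $p_N$ is continuous; (b) $\inf_{y\in L_N}\|w_N^k-y\|_{\mathbb{X}}\ge \alpha_N>0$ for all $k\ge 0$; (c) $\inf_{N\ge 0}\ \inf_{v\in S_{L_N^\perp}\cap \mathbb{X}_N}\mathsf{E}(p_N(v))>-\infty$. Let $C_{\mathsf{E}}:=\{w\in\mathbb{X}:\ \mathsf{E}'(w)=0 \text{ in } \mathbb{X}^\star\}$ be the set of critical points of $\mathsf{E}$. Then the following two convergence properties hold true: (I) If there exists an index $N\ge 0$ such that the while loop of the algorithm on $\mathbb{X}_N$ does not terminate, and if $\mathsf{E}':\mathbb{X}\to\mathbb{X}^\star$ is continuous on the subspace $\mathbb{X}_N$, then the generated sequence $\{w_N^k\}_{k\ge 0}\subset\mathbb{X}_N$ converges to $C_{\mathsf{E}}$ in the sense that $$\lim_{k\to\infty}\ \inf_{y\in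 C_{\mathsf{E}}}\|w_N^k-y\|_{\mathbb{X}}=0 .$$ (II) Otherwise, for each $N\ge 0$, suppose that there exists a finite integer $k^\star=k^\star(N)\in\mathbb{N}$ such that the stopping criterion $$\|\mathsf{R}_N(w_N^{k^\star})\|_{\mathbb{X}}\le \min\left(\gamma\,\eta_N(w_N^{k^\star}),\,\sigma(N)\right)$$ is satisfied (so that $w_N^{k^\star}$ is the final approximation on $\mathbb{X}_N$). Moreover, let the sequence of Galerkin spaces be dense in $\mathbb{X}$, i.e. $\mathbb{X}=\overline{\bigcup_{N\ge 0}\mathbb{X}_N}$. Furthermore, for any infinite subset $J\subseteq\mathbb{N}$, assume that the corresponding sequence $\{\mathsf{E}'(w_N^{k^\star})\}_{N\in J}$ has a converging subsequence in $\mathbb{X}^\star$. Then $$\inf_{y\in C_{\mathsf{E}}}\|w_N^{k^\star}-y\|_{\mathbb{X}}\to 0\qquad\text{as } N\to\infty .$$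
   Context: Setting. $\mathbb{X}$ is a real Hilbert space with inner product $(\cdot,\cdot)_{\mathbb{X}}$, norm $\|\cdot\|_{\mathbb{X}}$, dual space $\mathbb{X}^\star$ and duality pairing $\langle\cdot,\cdot\rangle$; the dual norm is $\|\phi\|_{\mathbb{X}^\star}=\sup_{\|y\|_{\mathbb{X}}=1}\langle\phi,y\rangle$. $\mathsf{E}\in C^1(\mathbb{X};\mathbb{R})$ has Fréchet derivative $\mathsf{E}'$; a critical point is $u\in\mathbb{X}$ with $\mathsf{E}'(u)=0$. Palais--Smale condition (PS): any sequence $\{u^k\}_k\subset\mathbb{X}$ for which $\{\mathsf{E}(u^k)\}_k$ is bounded in $\mathbb{R}$ and $\mathsf{E}'(u^k)\to0$ in $\mathbb{X}^\star$ possesses a convergent subsequence. Peak selection. For a closed subspace $L$ of a Hilbert space, with orthogonal complement $L^\perp$, let $S_{L^\perp}=\{v\in L^\perp:\|v\|_{\mathbb{X}}=1\}$, and for $v\in S_{L^\perp}$ let $L_v=\{u+tv: u\in L,\ t\ge0\}$. Let $\mathcal{P}(L_v)$ be the set of all local maxima of $\mathsf{E}$ in $L_v$, i.e. of points $w_0\in L_v$ for which there is $\delta>0$ with $\mathsf{E}(w)\le\mathsf{E}(w_0)$ for all $w\in L_v$ with $\|w-w_0\|_{\mathbb{X}}<\delta$. A peak selection of $\mathsf{E}$ with respect to $L$ is a single-valued map $p$ on $S_{L^\perp}$ with $p(v)\in\mathcal{P}(L_v)$ for all $v\in S_{L^\perp}$. On a Galerkin space $\mathbb{X}_N$ with subspace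 $L_N\subset\mathbb{X}_N$, the peak selection $p_N$ is defined on $S_{L_N^\perp}\cap\mathbb{X}_N$, with $p_N(v)\in \mathcal{P}((L_N)_v)$. Discrete residual. For a finite-dimensional subspace $\mathbb{X}_N\subset\mathbb{X}$ and $w\in\mathbb{X}$, $\mathsf{R}_N(w)\in\mathbb{X}_N$ is defined by $(\mathsf{R}_N(w),v)_{\mathbb{X}}=\langle\mathsf{E}'(w),v\rangle$ for all $v\in\mathbb{X}_N$. Standing data. $\sigma:\mathbb{N}_0\to(0,\infty)$ is a given function with $\sigma(N)\to0$ as $N\to\infty$. $\eta_N:\mathbb{X}_N\to[0,\infty)$ is a computable error indicator satisfying $\|\mathsf{E}'(v)\|_{\mathbb{X}^\star}\le C\,\eta_N(v)$ for all $v\in\mathbb{X}_N$, with a constant $C>0$ independent of $\mathbb{X}_N$; it comprises local contributions that are used to enrich the Galerkin space. Adaptive local minimax Galerkin (LMMG) algorithm. Input: finitely many previously found critical points $w_1,\dots,w_{n-1}$ of $\mathsf{E}$ with $\mathsf{E}(w_1)\le\dots\le\mathsf{E}(w_{n-1})$ (possibly none, in which case the spaces $L_N$ below are $\{0\}$); a steering parameter $\gamma>0$; a step size control $\lambda>0$; a tolerance $\epsilon_{\mathrm{tol}}$; an initial finite-dimensional space $\mathbb{X}_0\subset\mathbb{X}$. Set $N=0$, let $L_0=\mathrm{span}\{w_{0,1},\dots,w_{0,n-1}\}\subset\mathbb{X}_0$ with suitable approximations $w_{0,i}\in\mathbb{X}_0$ of $w_i$, and choose $v_0^0\in S_{L_0^\perp}\cap\mathbb{X}_0$,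 an (ascent) direction at $w_{0,n-1}$. Repeat: 1. Set $k=0$. Using a peak selection $p_N$ of $\mathsf{E}$ with respect to $L_N$ on $\mathbb{X}_N$, determine $w_N^0=p_N(v_N^0)=t_N^0v_N^0+u_N^0$ (with $u_N^0\in L_N$, $t_N^0\ge0$). 2. While loop: while $\|\mathsf{R}_N(w_N^k)\|_{\mathbb{X}}>\gamma\,\eta_N(w_N^k)$ or $\|\mathsf{R}_N(w_N^k)\|_{\mathbb{X}}>\sigma(N)$, do the following. Compute the steepest descent direction $d_N^k:=-\mathsf{R}_N(w_N^k)$. Set $v_N^k(s)=\dfrac{v_N^k+s\,d_N^k}{\|v_N^k+s\,d_N^k\|_{\mathbb{X}}}$ for $s>0$. Let $s_N^k=\lambda/2^m$, where $m\in\mathbb{Z}$ is the minimal integer such that $2^m>\|d_N^k\|_{\mathbb{X}}$ and $$\mathsf{E}\left(p_N(v_N^k(\lambda/2^m))\right)-\mathsf{E}(w_N^k)\le-\tfrac12\,t_N^k\,\|d_N^k\|_{\mathbb{X}}\,\|v_N^k(\lambda/2^m)-v_N^k\|_{\mathbb{X}}.$$ Set $v_N^{k+1}=v_N^k(s_N^k)$ and $w_N^{k+1}=p_N(v_N^{k+1})=t_N^{k+1}v_N^{k+1}+u_N^{k+1}$ with unique $u_N^{k+1}\in L_N$, $t_N^{k+1}\ge0$. Update $k\gets k+1$. 3. When the while loop has terminated (at index $k=k^\star(N)$), enrich the space $\mathbb{X}_N$ to a finite-dimensional space $\mathbb{X}_{N+1}$ with $\mathbb{X}_N\subset\mathbb{X}_{N+1}\subset\mathbb{X}$,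 using the local error indicators $\eta_N(w_N^k)$. Define $w_{N+1}^0:=w_N^k$ and $v_{N+1}^0:=v_N^k$ by inclusion $\mathbb{X}_N\hookrightarrow\mathbb{X}_{N+1}$. Update $N\gets N+1$, and let $L_N=\mathrm{span}\{w_{N,1},\dots,w_{N,n-1}\}\subset\mathbb{X}_N$, where $w_{N,i}$ is a suitable approximation of $w_i$ in $\mathbb{X}_N$, $1\le i\le n-1$. Until $\|\mathsf{R}_N(w_N^k)\|_{\mathbb{X}}<\epsilon_{\mathrm{tol}}$ (for $\epsilon_{\mathrm{tol}}=0$ the outer loop never stops). *)

(* Defs.v *)
From HB Require Import structures.
From mathcomp Require Import all_boot all_order all_algebra.
From mathcomp Require Import all_classical all_reals all_analysis.
From mathcomp Require Import ring.

Set Implicit Arguments.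
Unset Strict Implicit.
Unset Printing Implicit Defensive.

Import Order.TTheory GRing.Theory Num.Theory.
Import numFieldNormedType.Exports.

Local Open Scope classical_set_scope.
Local Open Scope ring_scope.

(* A real Hilbert space is a complete normed module [X] over [R] together with
   a positive definite symmetric form [ip : {dot X for idfun}] that induces
   the norm of [X]. *)
Definition norm_induced_by (R : realType) (X : completeNormedModType R)
    (ip : {dot X for idfun}) : Prop :=
  forall x : X, `|x| = Num.sqrt (ip x x).

Section Dual.
Context {R : realType} {X : completeNormedModType R}.

(* Only meaningful for bounded linear [phi]: the set below is then bounded
   above.  It is empty when X = {0}, where [sup set0 = 0] is the right value. *)
Definition dual_norm (phi : X -> R) : R :=
  sup [set phi y | y in [set y : X | `|y| = 1]].

Definition dual_cvg (phi_ : nat -> X -> R) (phi : X -> R) : Prop :=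
  (fun k => dual_norm (fun y => phi_ k y - phi y)) @ \oo --> (0 : R).

Definition derivative_continuous_on (E : X -> R) (A : set X) : Prop :=
  forall x : X, A x ->
    dual_norm (fun y => 'd E z y - 'd E x y) @[z --> within A (nbhs x)]
      --> (0 : R).

Definition C1 (E : X -> R) : Prop :=
  (forall x : X, differentiable E x) /\ derivative_continuous_on E setT.

Definition critical_points (E : X -> R) : set X :=
  [set w | forall y : X, 'd E w y = 0].

Definition palais_smale (E : X -> R) : Prop :=
  forall u : nat -> X,
    bounded_fun (fun k => E (u k)) ->
    dual_cvg (fun k => 'd E (u k)) (fun=> 0) ->
    exists2 f : nat -> nat, increasing_seq f & cvgn (u \o f).

Definition has_dual_cvg_subseq (phi_ : nat -> X -> R) (J : set nat) : Prop :=
  exists f : nat -> nat, [/\ increasing_seq f, (forall i, J (f i)) &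
    exists2 phi : {linear X -> R}, continuous phi &
      dual_cvg (fun i => phi_ (f i)) phi].

(* Extended-real valued, so that the distance to the empty set is [+oo]. *)
Definition dist_to (A : set X) (x : X) : \bar R :=
  ereal_inf [set `|x - y|%:E | y in A].

End Dual.

Section Subspaces.
Context {R : realType} {X : completeNormedModType R}.

Definition lspan (m : nat) (f : 'I_m -> X) : set X :=
  [set x | exists c : 'I_m -> R, x = \sum_(i < m) c i *: f i].

Definition finite_dim_subspace (V : set X) : Prop :=
  exists (m : nat) (f : 'I_m -> X), V = lspan f.

Lemma lspanP_lin (m : nat) (f : 'I_m -> X) (a : R) (x y : X) :
  lspan f x -> lspan f y -> lspan f (a *: x + y).
Proof.
move=> [c ->] [d ->]; exists (fun i => a * c i + d i).
rewrite scaler_sumr -big_split /=; apply: eq_bigr => i _.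
by rewrite scalerDl scalerA.
Qed.

Lemma lspan_gen (m : nat) (f : 'I_m -> X) (i : 'I_m) : lspan f (f i).
Proof.
exists (fun j => (j == i)%:R); rewrite (bigD1 i) //= eqxx scale1r big1 ?addr0 //.
by move=> j /negPf ->; rewrite scale0r.
Qed.

Lemma lspan_eq_on (m : nat) (f : 'I_m -> X) (phi psi : {linear X -> R}) :
  (forall i, phi (f i) = psi (f i)) -> forall v, lspan f v -> phi v = psi v.
Proof.
move=> h v [c ->]; rewrite !linear_sum; apply: eq_bigr => i _.
by rewrite !linearZ /= h.
Qed.

Lemma lspan_riesz (ip : {dot X for idfun}) (m : nat) (f : 'I_m -> X)
    (phi : {linear X -> R}) :
  exists2 r, lspan f r & forall v, lspan f v -> ip r v = phi v.
Proof.
elim: m f phi => [|m IH] f phi.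
  exists 0; first by exists (fun=> 0); rewrite big_ord0.
  by move=> v [c ->]; rewrite big_ord0 !linear0.
pose g i := f (widen_ord (leqnSn m) i).
have sub x : lspan g x -> lspan f x.
  case=> c ->; elim/big_ind: _ => [|x1 x2 h1 h2|i _].
  - by exists (fun=> 0); rewrite big1 // => i _; rewrite scale0r.
  - by rewrite -[x1]scale1r; apply: lspanP_lin.
  - rewrite -[_ *: _]addr0; apply: lspanP_lin; first exact: lspan_gen.
    by exists (fun=> 0); rewrite big1 // => j _; rewrite scale0r.
have [r rg rP] := IH g phi.
have [q qg qP] := IH g (ip (f ord_max)).
pose e := f ord_max - q.
have dec v : lspan f v -> exists a, exists2 x, lspan g x & v = a *: e + x.
  case=> c ->; rewrite big_ord_recr /=; exists (c ord_max).
  exists (c ord_max *: q + \sum_(i < m) c (widen_ord (leqnSn m) i) *: g i).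
    by apply: lspanP_lin => //; exists (fun i => c (widen_ord (leqnSn m) i)).
  by rewrite addrA -scalerDr subrK addrC.
have eg x : lspan g x -> ip e x = 0.
  by move=> xg; rewrite linearBl /= qP// subrr.
have [e0|e0] := eqVneq e 0.
  exists r; first exact: sub.
  by move=> v /dec[a [x xg ->]]; rewrite e0 scaler0 add0r rP.
have ee : ip e e != 0 by apply: lt0r_neq0; exact: neq0_dnorm_gt0.
exists (((phi e - ip r e) / ip e e) *: e + r).
  apply: lspanP_lin; last exact: sub.
  rewrite /e -scaleN1r addrC; apply: lspanP_lin; first exact: sub.
  exact: lspan_gen.
move=> v /dec[a [x xg ->]].
have -> : ip (((phi e - ip r e) / ip e e) *: e + r) (a *: e + x) =
    (phi e - ip r e) / ip e e * (a * ip e e + ip e x) +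
    (a * ip r e + ip r x) by rewrite linearPl /= !linearPr.
have -> : phi (a *: e + x) = a * phi e + phi x by rewrite linearP.
by rewrite (eg _ xg) (rP _ xg); field.
Qed.

Context (ip : {dot X for idfun}) (E : X -> R).

Definition unit_sphere_perp (L V : set X) : set X :=
  [set v | [/\ V v, (forall y, L y -> ip v y = 0) & `|v| = 1]].

Definition half_space (L : set X) (v : X) : set X :=
  [set x | exists u : X, exists t : R, [/\ L u, 0 <= t & x = u + t *: v]].

Definition local_maxima (A : set X) : set X :=
  [set w0 | A w0 /\ exists2 delta : R, 0 < delta &
     forall w, A w -> `|w - w0| < delta -> E w <= E w0].

(* The values of [p] off [unit_sphere_perp L V] are irrelevant. *)
Definition peak_selection (L V : set X) (p : X -> X) : Prop :=
  forall v, unit_sphere_perp L V v -> local_maxima (half_space L v) (p v).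

Definition is_residual (V : set X) (w r : X) : Prop :=
  V r /\ forall v, V v -> ip r v = 'd E w v.

Definition residual (V : set X) (w : X) : X := xget 0 (is_residual V w).

Lemma residualP (V : set X) (w : X) :
  finite_dim_subspace V -> is_residual V w (residual V w).
Proof.
move=> [m [f ->]]; have [r rf rP] := lspan_riesz ip f ('d E w).
by apply: (@xgetPex _ 0 (is_residual (lspan f) w)); exists r.
Qed.

Lemma is_residual_unique (V : set X) (w r r' : X) :
  finite_dim_subspace V -> is_residual V w r -> is_residual V w r' -> r = r'.
Proof.
move=> [m [f ->]] [rf rP] [r'f r'P]; apply/eqP; rewrite -subr_eq0.
apply: contraT => /(neq0_dnorm_gt0 (s := ip)).
have d : lspan f (r - r') by rewrite -scaleN1r addrC; apply: lspanP_lin.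
by rewrite linearBl /= rP// r'P// subrr ltxx.
Qed.

End Subspaces.

Section Algorithm.
Context {R : realType} {X : completeNormedModType R}.

(* Everything produced by a run: Galerkin spaces, approximations of the known
   critical points, peak selections, and the iterates v_N^k and
   w_N^k = t_N^k v_N^k + u_N^k.  [approx N i] is the approximation of the
   (i+1)-st previously found critical point.  If the inner loop on the N-th
   space does not terminate, the entries with larger first index are junk;
   likewise [vi N k], ... for [k] beyond the end of the N-th inner loop.  The
   predicates [reached] and [generated] below delimit the meaningful part. *)
Record lmmg_trace (n : nat) := LmmgTrace {
  gspace : nat -> set X;
  approx : nat -> 'I_n.-1 -> X;
  peak   : nat -> X -> X;
  vi     : nat -> nat -> X;
  wi     : nat -> nat -> X;
  ti     : nat -> nat -> R;
  ui     : nat -> nat -> X }.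

Context (ip : {dot X for idfun}) (E : X -> R).
Context (sigma : nat -> R) (eta : nat -> X -> R) (gamma lambda eps_tol : R).
Context (n : nat) (T : lmmg_trace n).

Definition L_ (N : nat) : set X := lspan (approx T N).

Definition sphere (N : nat) : set X :=
  unit_sphere_perp ip (L_ N) (gspace T N).

Definition res (N k : nat) : X := residual ip E (gspace T N) (wi T N k).

Definition while_cond (N k : nat) : bool :=
  (gamma * eta N (wi T N k) < `|res N k|) || (sigma N < `|res N k|).

Definition loop_ends_at (N k : nat) : Prop :=
  (forall j, (j < k)%N -> while_cond N j) /\ ~~ while_cond N k.

Definition reached (N : nat) : Prop :=
  forall M, (M < N)%N ->
    exists2 k, loop_ends_at M k & ~~ (`|res M k| < eps_tol).

Definition generated (N k : nat) : Prop :=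
  reached N /\ forall j, (j < k)%N -> while_cond N j.

Definition descent_dir (N k : nat) : X := - res N k.

Definition v_of (N k : nat) (s : R) : X :=
  let y := vi T N k + s *: descent_dir N k in `|y|^-1 *: y.

Definition step_admissible (N k : nat) (m : int) : Prop :=
  let v' := v_of N k (lambda / 2 ^ m) in
  `|descent_dir N k| < 2 ^ m /\
  E (peak T N v') - E (wi T N k) <=
    - (1 / 2 * ti T N k * `|descent_dir N k| * `|v' - vi T N k|).

Definition step_exponent (N k : nat) (m : int) : Prop :=
  step_admissible N k m /\ forall m', step_admissible N k m' -> m <= m'.

Record lmmg_run : Prop := LmmgRun {
  run_space : forall N, reached N -> finite_dim_subspace (gspace T N);
  run_approx : forall N i, reached N -> gspace T N (approx T N i);
  run_peak : forall N, reached N ->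
    peak_selection ip E (L_ N) (gspace T N) (peak T N);
  (* for N > 0 this is what the evaluation of the peak selection at the
     inherited direction presupposes *)
  run_v0 : forall N, reached N -> sphere N (vi T N 0);
  run_w : forall N k, generated N k ->
    [/\ wi T N k = peak T N (vi T N k),
        wi T N k = ti T N k *: vi T N k + ui T N k,
        L_ N (ui T N k) & 0 <= ti T N k];
  run_step : forall N k, generated N k.+1 ->
    exists2 m : int, step_exponent N k m &
      vi T N k.+1 = v_of N k (lambda / 2 ^ m);
  run_enrich : forall N k, reached N.+1 -> loop_ends_at N k ->
    [/\ gspace T N `<=` gspace T N.+1,
        wi T N.+1 0 = wi T N k & vi T N.+1 0 = vi T N k] }.

Definition lmmg_input (wprev : 'I_n.-1 -> X) : Prop :=
  (forall i, critical_points E (wprev i)) /\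
  (forall i j : 'I_n.-1, (i <= j)%N -> E (wprev i) <= E (wprev j)).

Definition error_indicator (C : R) : Prop :=
  forall N v, reached N -> gspace T N v ->
    0 <= eta N v /\ dual_norm ('d E v) <= C * eta N v.

End Algorithm.

(* Main.v *)
(* (I) On a fixed Galerkin space the unit sphere is compact, so if the residuals
   R(w^k) did not tend to 0, the directions v^k would cluster at some v* with
   R(p v* ) <> 0.  Near such a v* the step size rule accepts all steps below a
   uniform threshold, hence the energy would drop infinitely often by a fixed
   amount, contradicting (c).  Once the residuals are below sigma(N), the loop
   condition bounds |E'(w^k)| by (C / gamma) |R(w^k)|, and (PS) applies to every
   subsequence.

   The acceptance threshold is uniform although the radius on which p v is a
   local maximum is not: along s |-> v(s) the local maximality at p(v(s)) bounds
   the right Dini derivative of s |-> E(p(v(s))) by a negative constant, and a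
   continuous function with this property decreases at least linearly.

   (II) The energies of the final iterates are nonincreasing, and a dual limit of
   E'(w_N) vanishes on every X_M because |R_N(w_N)| <= sigma(N) -> 0; by density
   it is 0, and (PS) applies to every subsequence. *)
Require Import Defs.
From mathcomp Require Import all_boot all_order all_algebra.
From mathcomp Require Import all_classical all_reals all_analysis.
From mathcomp Require Import ring lra.
Import Order.TTheory GRing.Theory Num.Theory.
Import numFieldNormedType.Exports.
Local Open Scope classical_set_scope.
Local Open Scope ring_scope.

Set Implicit Arguments.
Unset Strict Implicit.
Unset Printing Implicit Defensive.

(** * The inner product and the norm it induces *)

Section InnerProduct.
Context {R : realType} {X : completeNormedModType R} (ip : {dot X for idfun}).
Hypothesis hip : norm_induced_by ip.

Lemma ipC (x y : X) : ip x y = ip y x.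
Proof. by rewrite hermC /= expr0 mul1r. Qed.

Lemma ipDl (x y z : X) : ip (x + y) z = ip x z + ip y z.
Proof. by rewrite linearDl. Qed.

Lemma ipDr (x y z : X) : ip x (y + z) = ip x y + ip x z.
Proof. by rewrite linearD. Qed.

Lemma ipZl (a : R) (x y : X) : ip (a *: x) y = a * ip x y.
Proof. by rewrite linearZl_LR. Qed.

Lemma ipZr (a : R) (x y : X) : ip x (a *: y) = a * ip x y.
Proof. by rewrite linearZr. Qed.

Lemma ipNl (x y : X) : ip (- x) y = - ip x y.
Proof. by rewrite linearNl. Qed.

Lemma ipNr (x y : X) : ip x (- y) = - ip x y.
Proof. by rewrite linearN. Qed.

Lemma ip_ge0 (x : X) : 0 <= ip x x.
Proof.
have [->|x0] := eqVneq x 0; first by rewrite linear0r.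
by apply: ltW; exact: neq0_dnorm_gt0.
Qed.

Lemma ip_norm (x : X) : ip x x = `|x| ^+ 2.
Proof. by rewrite hip sqr_sqrtr// ip_ge0. Qed.

(** Reduces the continuity of [ip] to that of the norm. *)
Lemma ip_polarization (x y : X) :
  ip x y = (`|x + y| ^+ 2 - `|x - y| ^+ 2) / 4.
Proof.
rewrite -!ip_norm !(ipDl, ipDr, ipNl, ipNr) (ipC y x); lra.
Qed.

Lemma cvg_ip (T : Type) (F : set_system T) {FF : Filter F} (f g : T -> X)
    (a b : X) : f @ F --> a -> g @ F --> b ->
  ip (f x) (g x) @[x --> F] --> ip a b.
Proof.
move=> fa gb; rewrite ip_polarization.
under eq_fun do rewrite ip_polarization.
apply: cvgMl; apply: cvgB; under eq_fun do rewrite expr2; rewrite expr2.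
  by apply: cvgM; apply: cvg_norm; exact: cvgD.
by apply: cvgM; apply: cvg_norm; exact: cvgB.
Qed.

Lemma ip_cauchy_schwarz (x y : X) : `|ip x y| <= `|x| * `|y|.
Proof.
have [->|y0] := eqVneq y 0; first by rewrite linear0r !normr0 mulr0.
have yy : 0 < ip y y by exact: neq0_dnorm_gt0.
rewrite -ler_sqr ?nnegrE ?mulr_ge0// exprMn -!ip_norm real_normK ?num_real//.
rewrite -(ler_pM2r yy).
(* Up to the factor (y,y) this vector is the component of x orthogonal to y. The scaling avoids a
   division, and the goal has been multiplied by (y,y) to match. *)
have := ip_ge0 (ip y y *: x - ip x y *: y).
rewrite !(ipDl, ipDr, ipNl, ipNr, ipZl, ipZr) (ipC y x) => h.
by nra.
Qed.

Lemma ip_pythagoras (x y : X) : ip x y = 0 ->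
  `|x + y| ^+ 2 = `|x| ^+ 2 + `|y| ^+ 2.
Proof. by move=> xy; rewrite -!ip_norm !(ipDl, ipDr) (ipC y x) xy; ring. Qed.

End InnerProduct.

(** * Spans and compactness in finite dimension *)

Section Subspaces.
Context {R : realType} {X : completeNormedModType R} (ip : {dot X for idfun}).
Hypothesis hip : norm_induced_by ip.

Lemma lspan0 (m : nat) (f : 'I_m -> X) : lspan f 0.
Proof. by exists (fun=> 0); rewrite big1// => i _; rewrite scale0r. Qed.

Lemma lspanZ (m : nat) (f : 'I_m -> X) (a : R) (x : X) :
  lspan f x -> lspan f (a *: x).
Proof. by move=> fx; rewrite -[_ *: _]addr0; apply: lspanP_lin => //; exact: lspan0. Qed.

Lemma lspanD (m : nat) (f : 'I_m -> X) (x y : X) :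
  lspan f x -> lspan f y -> lspan f (x + y).
Proof. by move=> fx fy; rewrite -[x]scale1r; exact: lspanP_lin. Qed.

Lemma lspanB (m : nat) (f : 'I_m -> X) (x y : X) :
  lspan f x -> lspan f y -> lspan f (x - y).
Proof. by move=> fx fy; apply: lspanD => //; rewrite -scaleN1r; exact: lspanZ. Qed.

Lemma lspan_sub (m k : nat) (f : 'I_m -> X) (g : 'I_k -> X) :
  (forall i, lspan g (f i)) -> lspan f `<=` lspan g.
Proof.
move=> fg _ [c ->]; elim/big_ind: _ => [|x y|i _]; [exact: lspan0| |].
  exact: lspanD.
exact: lspanZ.
Qed.

(* Peel off the last generator: replacing it by its component orthogonal to
   the others bounds the coefficient by the norm of the vector. *)
Lemma lspan_ball_compact (m : nat) (f : 'I_m -> X) (M : R) :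
  exists K : set X, [/\ compact K, K `<=` lspan f &
    forall x, lspan f x -> `|x| <= M -> K x].
Proof.
elim: m f M => [|m IH] f M.
  exists [set 0]; split; first exact: compact_set1.
    by move=> _ ->; exact: lspan0.
  by move=> _ [c ->] _; rewrite big_ord0.
pose g i := f (widen_ord (leqnSn m) i).
have sub : lspan g `<=` lspan f by apply: lspan_sub => i; exact: lspan_gen.
have [q qg qP] := lspan_riesz ip g (ip (f ord_max)).
pose e := f ord_max - q.
have fe : lspan f e by apply: lspanB; [exact: lspan_gen|exact: sub].
have eg x : lspan g x -> ip e x = 0.
  by move=> xg; rewrite linearBl /= qP// subrr.
have dec v : lspan f v -> exists a, exists2 x, lspan g x & v = a *: e + x.
  case=> c ->; rewrite big_ord_recr /=; exists (c ord_max).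
  exists (c ord_max *: q + \sum_(i < m) c (widen_ord (leqnSn m) i) *: g i).
    by apply: lspanP_lin => //; exists (fun i => c (widen_ord (leqnSn m) i)).
  by rewrite addrA -scalerDr subrK addrC.
have [e0|e0] := eqVneq e 0.
  have [K [cK Kg KM]] := IH g M; exists K; split => //.
    by move=> x /Kg/sub.
  by move=> _ /dec[a [x gx ->]]; rewrite e0 scaler0 add0r => xM; exact: KM.
have e_gt0 : 0 < `|e| by rewrite normr_gt0.
have [K [cK Kg KM]] := IH g M.
pose A := `[- (M / `|e|), M / `|e|]%classic : set R.
exists [set z.1 *: e + z.2 | z in A `*` K]; split.
- apply: continuous_compact; last first.
    by apply: compact_setX => //; exact: segment_compact.
  apply: continuous_subspaceT => z; apply: cvgD; last exact: cvg_snd.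
  by apply: cvgZl; exact: cvg_fst.
- by move=> _ [[a x] /= [_ Kx] <-]; apply: lspanP_lin => //; exact/sub/Kg.
- move=> _ /dec[a [x gx ->]] aexM.
  have : `|a *: e + x| ^+ 2 <= M ^+ 2.
    by rewrite ler_sqr ?nnegrE// (le_trans _ aexM).
  have M0 : 0 <= M by exact: le_trans aexM.
  rewrite (ip_pythagoras hip); last by rewrite ipZl eg// mulr0.
  move=> le2; exists (a, x) => //=; split.
    rewrite /A/= in_itv/= -ler_norml ler_pdivlMr// -normrZ.
    rewrite -ler_sqr ?nnegrE//; apply: le_trans le2.
    by rewrite lerDl sqr_ge0.
  apply: KM => //; rewrite -ler_sqr ?nnegrE//; apply: le_trans le2.
  by rewrite lerDr sqr_ge0.
Qed.

(** The compact set [K] contains the unit ball of V and lies inside V, so intersecting it with the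
    closed conditions on the norm and on orthogonality gives exactly the sphere; closedness of V
    need not be shown separately. *)
Lemma unit_sphere_perp_compact (L V : set X) :
  finite_dim_subspace V -> compact (unit_sphere_perp ip L V).
Proof.
case=> m [f ->]; have [K [cK Kf K1]] := lspan_ball_compact f 1.
have -> : unit_sphere_perp ip L (lspan f) =
    K `&` ([set v | `|v| = 1] `&` \bigcap_(y in L) [set v | ip v y = 0]).
  apply/seteqP; split => v /=.
    by case=> fv vL v1; split => //; apply: K1 => //; rewrite v1.
  by case=> /Kf fv [v1 vL]; split.
apply: compact_closedI => //; apply: closedI.
  apply: (@closed_comp _ _ (fun v : X => `|v|) [set 1]) => [v _|].
    exact: norm_continuous.
  exact: closed_eq.
apply: closed_bigI => y _.
apply: (@closed_comp _ _ (fun v : X => ip v y) [set 0]) => [v _|].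
  by apply: cvg_ip => //; exact: cvg_cst.
exact: closed_eq.
Qed.

End Subspaces.

(** * The dual norm and calculus along lines *)

Section Calculus.
Context {R : realType} {X : completeNormedModType R}.

Lemma dual_norm_bound (phi : {linear X -> R}) (y : X) :
  continuous phi -> `|phi y| <= dual_norm phi * `|y|.
Proof.
move=> cphi.
(* A supremum bounds its set only if the set is bounded above; continuity of [phi] provides this. *)
have [M phiM] : exists M, forall x, `|phi x| <= M * `|x|.
  have /linear_boundedP[M [_ /(_ (M + 1))]] :=
    continuous_linear_bounded 0 (cphi 0).
  by rewrite ltrDl ltr01 => /(_ isT) h; exists (M + 1).
have [->|y0] := eqVneq y 0; first by rewrite linear0 !normr0 mulr0.
have y_gt0 : 0 < `|y| by rewrite normr_gt0.
have bnd x : `|x| = 1 -> phi x <= dual_norm phi.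
  move=> x1; apply: sup_upper_bound; last by exists x.
  split; first by exists (phi x), x.
  exists M => _ [z /= z1 <-]; apply: le_trans (ler_norm _) _.
  by have := phiM z; rewrite z1 mulr1.
pose z := `|y|^-1 *: y.
have z1 : `|z| = 1.
  by rewrite normrZ normfV normr_id mulVf// gt_eqF.
have yz : y = `|y| *: z by rewrite scalerA divff ?gt_eqF// scale1r.
rewrite {1}yz linearZ/= normrM normr_id mulrC ler_pM2r// ler_norml bnd//.
(* The supremum is taken without absolute values; the lower bound comes from the unit vector -z. *)
rewrite -lerN2 opprK andbT -linearN bnd//.
by rewrite normrN.
Qed.

Lemma dual_norm_ge0 (phi : {linear X -> R}) :
  continuous phi -> 0 <= dual_norm phi.
Proof.
move=> cphi.
have [[y /= y1]|S0] := pselect ([set y : X | `|y| = 1] !=set0).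
  by have := dual_norm_bound y cphi; rewrite y1 mulr1; exact: le_trans.
rewrite /dual_norm (_ : [set y | _] = set0) ?image_set0 ?sup0//.
by apply/seteqP; split => // y ?; apply: S0; exists y.
Qed.

Lemma dual_norm_sub_bound (phi psi : {linear X -> R}) (y : X) :
  continuous phi -> continuous psi ->
  `|phi y - psi y| <= dual_norm (fun z => phi z - psi z) * `|y|.
Proof.
move=> cphi cpsi; apply: (dual_norm_bound (phi := phi \- psi : {linear X -> R})).
by move=> x; apply: cvgB; [exact: cphi|exact: cpsi].
Qed.

Variable E : X -> R.
Hypothesis hE : C1 E.

Let dE (x : X) : differentiable E x := hE.1 x.

Lemma C1_continuous : continuous E.
Proof. by move=> x; exact: differentiable_continuous. Qed.

Lemma C1_diff_continuous (x : X) : continuous ('d E x).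
Proof. exact: diff_continuous. Qed.

(** Continuity of E' in the dual norm, in the form used below: one neighbourhood serves all
    directions y. *)
Lemma C1_near (x : X) (e : R) : 0 < e ->
  \forall z \near x, forall y, `|'d E z y - 'd E x y| <= e * `|y|.
Proof.
move=> e0; have /cvgrPdist_lt/(_ _ e0) := hE.2 x I; rewrite near_withinE.
apply: filterS => z /(_ I); rewrite sub0r normrN => ze y.
apply: le_trans (dual_norm_sub_bound _ _ _) _; try exact: C1_diff_continuous.
apply: ler_wpM2r => //; apply: ltW; exact: le_lt_trans (ler_norm _) ze.
Qed.

Lemma is_derive_line (a b : X) (h : R) :
  is_derive h 1 (fun t : R => E (a + t *: b)) ('d E (a + h *: b) b).
Proof.
have line : (fun t : R => t^-1 *: (((fun u : R => E (a + u *: b)) \o shift h)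
      (t *: (1 : R)) - E (a + h *: b))) =
    (fun t : R => t^-1 *: ((E \o shift (a + h *: b)) (t *: b) - E (a + h *: b))).
  apply/funext => t /=; congr (_ *: (E _ - _)).
  by rewrite [t *: 1]mulr1 scalerDl addrCA.
apply: DeriveDef; first by rewrite /derivable line; exact: diff_derivable.
by rewrite /derive line -deriveE.
Qed.

Lemma mean_value (a b : X) :
  exists2 th : R, 0 <= th <= 1 & E (a + b) - E a = 'd E (a + th *: b) b.
Proof.
have [||th] := @MVT _ (fun t : R => E (a + t *: b))
  (fun t => 'd E (a + t *: b) b) 0 1 ltr01.
- by move=> t _; exact: is_derive_line.
- apply: continuous_subspaceT => t.
  apply: differentiable_continuous; apply/derivable1_diffP.
  exact: (@ex_derive _ _ _ _ _ _ _ (is_derive_line a b t)).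
rewrite in_itv/= => /andP[th0 th1].
rewrite scale1r scale0r addr0 subr0 mulr1 => ->.
by exists th => //; rewrite !ltW.
Qed.

Lemma diff_local_max (a b : X) (d : R) : 0 < d ->
  (forall h : R, `|h| < d -> E (a + h *: b) <= E a) -> 'd E a b = 0.
Proof.
move=> d0 amax.
have h0 : (0 : R) \in `]- d, d[%R by rewrite in_itv/= d0 oppr_lt0 d0.
have [||||_ D1] := @derive1_at_max R (fun t : R => E (a + t *: b)) (- d) d 0.
- by lra.
- move=> t _; exact: (@ex_derive _ _ _ _ _ _ _ (is_derive_line a b t)).
- exact: h0.
- move=> t; rewrite in_itv/= => td; rewrite scale0r addr0; apply: amax.
  by rewrite ltr_norml.
have [_] := is_derive_line a b 0.
by rewrite D1 scale0r addr0.
Qed.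

End Calculus.

(** By continuity the supremum of the points s in [0, b] with g s <= g 0 is itself such a point, and
    the local hypothesis moves beyond it unless it equals b. The radius [d] may depend on s without
    any positive lower bound. *)
Lemma right_local_decrease (R : realType) (g : R -> R) (b : R) :
  continuous g ->
  (forall s, 0 <= s -> s < b ->
     exists2 d, 0 < d & forall s', s < s' -> s' < s + d -> s' <= b -> g s' <= g s) ->
  0 <= b -> g b <= g 0.
Proof.
move=> cg loc b0.
pose A := [set s : R | 0 <= s <= b /\ g s <= g 0].
have A0 : A 0 by split => //; rewrite lexx.
have ubA : has_ubound A by exists b => s [/andP[]].
have Asup : A (sup A).
  suff cA : closed A by apply: cA; apply: closure_sup => //; exists 0.
  rewrite (_ : A = `[0, b]%classic `&` g @^-1` [set t | t <= g 0]); last first.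
    by apply/seteqP; split => s /=; rewrite in_itv.
  apply: closedI; first exact: interval_closed.
  apply: closed_comp; first by move=> s _; exact: cg.
  exact: closed_le.
have [/andP[s0 sb] gs] := Asup.
move: sb; rewrite le_eqVlt => /predU1P[<-//|sb].
have [d d0 dP] := loc _ s0 sb.
pose s' := Num.min b (sup A + d / 2).
have ss' : sup A < s' by rewrite lt_min sb ltrDl divr_gt0.
have As' : A s'.
  split; first by rewrite ge_min lexx (le_trans s0 (ltW ss')).
  apply: le_trans gs; apply: dP => //; last by rewrite ge_min lexx.
  by rewrite gt_min ltrD2l ltr_pdivrMr// mulr_natr mulr2n ltrDl d0 orbT.
by have := ub_le_sup ubA As'; rewrite leNgt ss'.
Qed.

(** * Subsequences, cluster points and distances *)

Section Subsequences.

Lemma increasing_seq_ge (f : nat -> nat) : increasing_seq f ->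
  forall n, (n <= f n)%N.
Proof.
move/increasing_seqP => fi; elim=> // n ih; exact: leq_ltn_trans ih (fi n).
Qed.

Lemma increasing_seq_cvg (f : nat -> nat) : increasing_seq f -> f @ \oo --> \oo.
Proof.
move=> fi P [N _ NP]; exists N => // n /= Nn; apply: NP => /=.
exact: leq_trans Nn (increasing_seq_ge fi n).
Qed.

Lemma not_near_infinite (P : set nat) :
  ~ (\forall k \near \oo, P k) -> infinite_set (~` P).
Proof.
apply: contra_not => /finite_seqP[s sP].
exists (\max_(i <- s) i).+1 => // k /= sk; apply: contrapT => nPk.
have : (~` P) k by [].
rewrite sP /= => ks; move: sk; rewrite ltnNge => /negP; apply.
exact: (leq_bigmax_seq (P := xpredT) (F := id)).
Qed.

Lemma infinite_subseq (J : set nat) : infinite_set J ->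
  exists2 f : nat -> nat, increasing_seq f & forall i, J (f i).
Proof.
move=> Joo; have /= [|f [fi _ Jf]] := infinite_increasing_seq_wf _ Joo 0%N.
  by move=> n; apply: sub_finite_set (finite_II n.+1) => m /=.
by exists f.
Qed.

Lemma not_near_subseq (P : set nat) : ~ (\forall k \near \oo, P k) ->
  exists2 f : nat -> nat, increasing_seq f & forall i, ~ P (f i).
Proof. by move=> /not_near_infinite/infinite_subseq. Qed.

(** Frequent visits to every neighbourhood of a cluster point suffice below, so no convergent
    subsequence is extracted. *)
Lemma compact_seq_frequently (T : topologicalType) (K : set T) (u : nat -> T) :
  compact K -> (forall n, K (u n)) ->
  exists2 a, K a & forall B, nbhs a B -> forall n, exists2 k, (n <= k)%N & B (u k).
Proof.
move=> cK Ku; have [|a [Ka au]] := cK (u @ \oo) _.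
  by exists 0%N => // n _; exact: Ku.
exists a => // B aB n.
have [|_ [[k nk <-] Bk]] := au [set u k | k in [set k | (n <= k)%N]] B _ aB.
  by exists n => // k /= nk; exists k.
by exists k.
Qed.

Lemma dist_to_cvg0 (R : realType) (X : completeNormedModType R) (A : set X)
    (x : nat -> X) :
  (forall J, infinite_set J -> exists f : nat -> nat, exists2 a,
     A a & (forall i, J (f i)) /\ x (f i) @[i --> \oo] --> a) ->
  dist_to A (x k) @[k --> \oo] --> 0%:E.
Proof.
move=> h.
have d0 k : (0 <= dist_to A (x k))%E.
  by apply/ereal_infP => _ [y _ <-]; rewrite lee_fin.
have near_dist (e : R) : 0 < e -> \forall k \near \oo, (dist_to A (x k) < e%:E)%E.
  move=> e0; apply: contrapT => /not_near_infinite/h[f [a Aa [fJ]]].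
  move=> /cvgrPdist_lt/(_ _ e0)[N _ /(_ N (leqnn N)) xa].
  apply: (fJ N); apply: le_lt_trans (_ : (`|x (f N) - a|%:E < _)%E).
    by apply: ereal_inf_lbound; exists a.
  by rewrite lte_fin distrC.
have fin (e : R) k : (dist_to A (x k) < e%:E)%E -> dist_to A (x k) \is a fin_num.
  by move=> de; rewrite ge0_fin_numE// (lt_trans de)// ltry.
(* Eventually the distance is below 1, hence finite, and convergence becomes a statement on
   reals. *)
apply/fine_cvgP; split.
  by apply: filterS (near_dist 1 ltr01) => k; exact: fin.
apply/cvgrPdist_lt => e e0; apply: filterS (near_dist e e0) => k de /=.
rewrite sub0r normrN ger0_norm ?fine_ge0//.
by rewrite -lte_fin fineK ?(fin e).
Qed.

End Subsequences.

(** * Critical limits from the Palais-Smale condition *)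

Section PalaisSmale.
Context {R : realType} {X : completeNormedModType R}.
Variable E : X -> R.
Hypotheses (hE : C1 E) (hPS : palais_smale E).

Lemma dual_norm_diff_bound (x y : X) : `|'d E x y| <= dual_norm ('d E x) * `|y|.
Proof. by apply: dual_norm_bound; exact: C1_diff_continuous. Qed.

Lemma critical_limit (u : nat -> X) (a : X) : u @ \oo --> a ->
  dual_norm ('d E (u k)) @[k --> \oo] --> (0 : R) -> critical_points E a.
Proof.
move=> ua du y; apply/eqP; rewrite -normr_le0; apply/ler_addgt0Pl => e e0.
rewrite addr0.
have y1 : 0 < `|y| + 1 by rewrite ltr_wpDl.
(* Chosen so that e' |y| <= e / 2; the summand 1 covers y = 0. *)
pose e' := e / 2 / (`|y| + 1); have e'0 : 0 < e' by rewrite !divr_gt0.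
near \oo => k.
have h1 : forall z, `|'d E (u k) z - 'd E a z| <= e' * `|z|.
  by near: k; exact: ua _ (C1_near hE a e'0).
have h2 : dual_norm ('d E (u k)) <= e'.
  apply: le_trans (ler_norm _) _; rewrite -normrN -sub0r.
  by near: k; apply: (cvgrPdist_le _ _).1.
have h3 : `|'d E (u k) y| <= e' * `|y|.
  by apply: le_trans (dual_norm_diff_bound _ _) _; exact: ler_wpM2r.
have h4 : e' * `|y| <= e / 2.
  by rewrite /e' mulrAC ler_pdivrMr// ler_wpM2l ?lerDl// ltW// divr_gt0.
rewrite -(subrK ('d E (u k) y) ('d E a y)).
apply: le_trans (ler_normD _ _) _; rewrite distrC [leRHS]splitr.
by apply: lerD; [exact: le_trans (h1 y) h4|exact: le_trans h3 h4].
Unshelve. all: by end_near. Qed.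

Lemma palais_smale_subseq (u : nat -> X) :
  bounded_fun (fun k => E (u k)) ->
  dual_norm ('d E (u k)) @[k --> \oo] --> (0 : R) ->
  exists f : nat -> nat, exists2 a,
    critical_points E a & u (f i) @[i --> \oo] --> a.
Proof.
move=> bu du; have [|f fi /cvg_ex[a ua]] := hPS bu.
  rewrite /dual_cvg; under eq_fun do under eq_fun do rewrite subr0.
  exact: du.
exists f, a => //; apply: critical_limit ua _.
by apply: cvg_comp (increasing_seq_cvg fi) du.
Qed.

End PalaisSmale.

(** * Relative continuity and closure properties of finite-dimensional subspaces *)

Lemma within_continuous_cvg (T U : topologicalType) (A : set T) (f : T -> U)
    (x : T) : {within A, continuous f} -> A x ->
  f y @[y --> within A (nbhs x)] --> f x.
Proof. by move=> cf Ax; rewrite (nbhs_subspace_in Ax); exact: cf. Qed.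

(** A peak selection is continuous only on the sphere; along a path that stays there it becomes a
    continuous function of the parameter. *)
Lemma continuous_comp_within (S T U : topologicalType) (A : set T)
    (f : T -> U) (h : S -> T) :
  {within A, continuous f} -> continuous h -> (forall s, A (h s)) ->
  continuous (f \o h).
Proof.
move=> cf ch Ah s; have cfs := within_continuous_cvg cf (Ah s).
apply: cvg_comp cfs => B /=; rewrite /within /= => hB.
apply: (@filterS _ (nbhs s) _ (h @^-1` [set y | A y -> B y])); last exact: ch.
by move=> z /(_ (Ah z)).
Qed.

Section FiniteDim.
Context {R : realType} {X : completeNormedModType R} (V : set X).
Hypothesis fV : finite_dim_subspace V.

Lemma fin_dimD (x y : X) : V x -> V y -> V (x + y).
Proof. by case: fV => m [f ->]; exact: lspanD. Qed.

Lemma fin_dimZ (a : R) (x : X) : V x -> V (a *: x).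
Proof. by case: fV => m [f ->]; exact: lspanZ. Qed.

Lemma fin_dimN (x : X) : V x -> V (- x).
Proof. by move=> Vx; rewrite -scaleN1r; exact: fin_dimZ. Qed.

Lemma fin_dimB (x y : X) : V x -> V y -> V (x - y).
Proof. by move=> Vx Vy; apply: fin_dimD => //; exact: fin_dimN. Qed.

Lemma fin_dim_lspan (m : nat) (f : 'I_m -> X) :
  (forall i, V (f i)) -> lspan f `<=` V.
Proof. by case: fV => k [g ->]; exact: lspan_sub. Qed.

End FiniteDim.

(** * Normalised paths on the unit sphere *)

Section NormalizedPath.
Context {R : realType} {X : completeNormedModType R} (ip : {dot X for idfun}).
Hypothesis hip : norm_induced_by ip.

Definition sphere_path (v d : X) (s : R) : X := `|v + s *: d|^-1 *: (v + s *: d).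

Variables (v d : X).
Hypotheses (v1 : `|v| = 1) (dv : ip d v = 0).

Lemma sphere_path_sqr_norm (s : R) : `|v + s *: d| ^+ 2 = 1 + (s * `|d|) ^+ 2.
Proof.
rewrite (ip_pythagoras hip); last by rewrite ipZr ipC dv mulr0.
by rewrite v1 expr1n normrZ !exprMn real_normK ?num_real.
Qed.

Lemma sphere_path_norm_ge1 (s : R) : 1 <= `|v + s *: d|.
Proof.
rewrite -ler_sqr ?nnegrE// sphere_path_sqr_norm expr1n lerDl; exact: sqr_ge0.
Qed.

Lemma sphere_path_norm_gt0 (s : R) : 0 < `|v + s *: d|.
Proof. exact: lt_le_trans (sphere_path_norm_ge1 s). Qed.

Lemma sphere_path_norm_le (s : R) : 0 <= s -> `|v + s *: d| <= 1 + s * `|d|.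
Proof.
by move=> s0; rewrite (le_trans (ler_normD _ _))// v1 normrZ ger0_norm.
Qed.

Lemma sphere_path0 : sphere_path v d 0 = v.
Proof. by rewrite /sphere_path scale0r addr0 v1 invr1 scale1r. Qed.

Lemma norm_sphere_path (s : R) : `|sphere_path v d s| = 1.
Proof. by rewrite normrZ normfV normr_id mulVf// gt_eqF// sphere_path_norm_gt0. Qed.

Lemma sphere_path_continuous : continuous (sphere_path v d).
Proof.
move=> s.
have c : (v + r *: d) @[r --> s] --> v + s *: d.
  by apply: cvgD; [exact: cvg_cst|apply: cvgZl; exact: cvg_id].
apply: cvgZ => //; apply: cvgV; first by rewrite gt_eqF// sphere_path_norm_gt0.
exact: cvg_norm.
Qed.

(** With n = |v + s d|, the squared distance is 2 - 2 / n while (s |d|)^2 = n^2 - 1. Their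
    difference is (n - 1)^2 (n + 2) / n, which is nonnegative. *)
Lemma sphere_path_dist_le (s : R) : 0 <= s -> `|sphere_path v d s - v| <= s * `|d|.
Proof.
move=> s0; have n1 := sphere_path_norm_ge1 s; have n2 := sphere_path_sqr_norm s.
have n0 := sphere_path_norm_gt0 s.
have sd0 : 0 <= s * `|d| by rewrite mulr_ge0.
rewrite -ler_sqr ?nnegrE//.
have -> : `|sphere_path v d s - v| ^+ 2 = 2 - 2 * `|v + s *: d|^-1.
  rewrite -(ip_norm hip) !(ipDl, ipDr, ipNl, ipNr) [ip v (sphere_path _ _ _)]ipC.
  rewrite !(ip_norm hip) norm_sphere_path v1 ipZl ipDl ipZl dv (ip_norm hip) v1.
  by ring.
have -> : (s * `|d|) ^+ 2 = `|v + s *: d| ^+ 2 - 1 by rewrite n2; ring.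
set n := `|v + s *: d| in n1 n0 *.
have -> : 2 - 2 * n^-1 = 2 * (n - 1) / n by field; rewrite gt_eqF.
rewrite ler_pdivrMr// -subr_ge0 [leRHS](_ : _ = (n - 1) ^+ 2 * (n + 2)); last by ring.
by rewrite mulr_ge0 ?sqr_ge0// addr_ge0// ltW.
Qed.

(** Testing the displacement against d gives s |d|^2 / |v + s d|; Cauchy-Schwarz and |v + s d| <= 1
    + s |d| conclude. This turns a lower bound on s |d| into one on the distance moved. *)
Lemma sphere_path_dist_ge (s : R) : 0 <= s ->
  s * `|d| / (1 + s * `|d|) <= `|sphere_path v d s - v|.
Proof.
move=> s0; have [->|d0] := eqVneq d 0; first by rewrite normr0 mulr0 mul0r.
have d_gt0 : 0 < `|d| by rewrite normr_gt0.
rewrite -(ler_pM2r d_gt0); apply: le_trans (ip_cauchy_schwarz hip _ _).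
have -> : ip (sphere_path v d s - v) d = s * `|d| ^+ 2 / `|v + s *: d|.
  rewrite ipDl ipNl ipZl ipDl ipZl (ipC _ v) dv (ip_norm hip); ring.
apply: le_trans (ler_norm _).
rewrite [leLHS](_ : _ = s * `|d| ^+ 2 / (1 + s * `|d|)); last by ring.
rewrite ler_wpM2l ?mulr_ge0 ?sqr_ge0// lef_pV2 ?posrE ?sphere_path_norm_gt0//.
  exact: sphere_path_norm_le.
by rewrite ltr_pwDl// mulr_ge0.
Qed.

End NormalizedPath.

(* D and T stand for the norm of the descent direction and the height at the
   reference direction v*; nearby values are kept within a factor 1 +- 1/32, which
   leaves the margin between the slope 3/4 and the required 1/2. *)
Section StepArithmetic.
Context {R : realFieldType}.
Implicit Types (D T e r s t x y : R).

Lemma slack_pos T t : 0 < T -> T - T / 32 < t -> 0 < t.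
Proof. lra. Qed.

Lemma slack_inner D x y : 0 < D -> x < D / 32 -> - (D * x) <= y ->
  31 / 32 * D ^+ 2 <= y + D ^+ 2.
Proof. by move=> D0 x1 y1; nra. Qed.

Lemma slack_radius D e r s t x y : 0 < r -> x <= s * t -> s * t <= e * t ->
  e * t <= 33 / 32 * (e * D) -> e * D <= r / 4 -> y < r / 2 -> x + y < r.
Proof. lra. Qed.

Lemma slack_segment D T e r s t x : 0 < T -> 0 < r -> 0 <= t -> 0 <= s ->
  t < T + T / 32 -> s <= 33 / 32 * (e * D) -> T * (e * D) <= r / 8 ->
  x <= t * s -> x < r / 2.
Proof.
move=> T0 r0 t0 s0 tT sD eD xts.
have : t * s <= (T + T / 32) * (33 / 32 * (e * D)) by apply: ler_pM => //; exact: ltW.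
by lra.
Qed.

Lemma slack_slope D t x y : 0 < D -> x <= y + D / 32 * t ->
  y <= - (31 / 32 * D ^+ 2) -> t <= 33 / 32 * D -> x <= - (14 / 16 * D ^+ 2).
Proof.
move=> D0 xy yD tD; have : D / 32 * t <= D / 32 * (33 / 32 * D).
  by rewrite ler_wpM2l//; lra.
have : 0 <= D ^+ 2 by exact: sqr_ge0.
by lra.
Qed.

Lemma slack_norm D e s t x : x <= 1 + s * t -> s * t <= e * t ->
  e * t <= 33 / 32 * (e * D) -> e * D <= 1 / 64 -> x <= 33 / 32.
Proof. lra. Qed.

Lemma slack_height T t x : 0 < T -> 1 <= x -> x <= 33 / 32 -> T - T / 32 < t ->
  15 / 17 * T <= t / x.
Proof.
move=> T0 x1 x2 tT; rewrite ler_pdivlMr ?(lt_le_trans ltr01)//.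
have : T * x <= T * (33 / 32) by rewrite ler_wpM2l// ltW.
by lra.
Qed.

Lemma slack_product D T x y : 0 < T -> 15 / 17 * T <= x ->
  y <= - (14 / 16 * D ^+ 2) -> x * y <= - (3 / 4 * T * D ^+ 2).
Proof.
move=> T0 xT yD.
have D2 : 0 <= D ^+ 2 by exact: sqr_ge0.
have : 15 / 17 * T * (14 / 16 * D ^+ 2) <= x * - y by apply: ler_pM; lra.
have : 0 <= T * D ^+ 2 by rewrite mulr_ge0// ltW.
by lra.
Qed.

Lemma slack_total D T s t x y : 0 < T -> 0 < D -> 0 <= s -> 0 <= t -> 0 <= x ->
  0 <= y -> t < T + T / 32 -> x <= 33 / 32 * D -> y <= s * x ->
  1 / 2 * t * x * y <= 3 / 4 * T * D ^+ 2 * s.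
Proof.
move=> T0 D0 s0 t0 x0 y0 tT xD ysx.
have : t * (x * y) <=
    (T + T / 32) * (33 / 32 * D * (s * (33 / 32 * D))).
  apply: ler_pM; rewrite ?mulr_ge0//; first exact: ltW.
  by apply: ler_pM => //; apply: le_trans ysx _; exact: ler_wpM2l.
have : 0 <= T * D ^+ 2 * s by rewrite !mulr_ge0 ?sqr_ge0// ltW.
by lra.
Qed.

(** Monotonicity in each factor, z / (1 + z) being increasing. In the application z is s |d| and q
    the distance moved on the sphere. *)
Lemma drop_lb (a b c x y z q : R) :
  0 < a -> 0 < b -> 0 < c -> a <= x -> b <= y -> c <= z -> z / (1 + z) <= q ->
  1 / 2 * a * b * (c / (1 + c)) <= 1 / 2 * x * y * q.
Proof.
move=> a0 b0 c0 ax by_ cz zq; have z0 : 0 < z by exact: lt_le_trans cz.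
have cz1 : c / (1 + c) <= z / (1 + z).
  rewrite ler_pdivrMr ?addr_gt0// mulrAC ler_pdivlMr ?addr_gt0//.
  by rewrite !mulrDr !mulr1 [c * z]mulrC lerD2r.
apply: ler_pM (le_trans cz1 zq).
- by rewrite mulr_ge0 ?(ltW b0)// mulr_ge0// ltW.
- by rewrite divr_ge0 ?addr_ge0// ltW.
- apply: ler_pM by_; [|exact: ltW|by rewrite ler_wpM2l].
  by rewrite mulr_ge0// ltW.
Qed.

End StepArithmetic.

(** * Peak selections and the step size rule *)

Section Peak.
Context {R : realType} {X : completeNormedModType R} (ip : {dot X for idfun}).
Hypothesis hip : norm_induced_by ip.
Variables (E : X -> R) (V : set X) (m : nat) (l : 'I_m -> X) (p : X -> X).
Hypotheses (hE : C1 E) (fV : finite_dim_subspace V).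
Hypothesis lV : forall i, V (l i).
Hypothesis hp : peak_selection ip E (lspan l) V p.

Let S := unit_sphere_perp ip (lspan l) V.
Let LV : lspan l `<=` V := fin_dim_lspan fV lV.

(** For v in the sphere this is the coefficient of v in p v, because v is a unit vector orthogonal
    to L. As an inner product it inherits the continuity of p. *)
Definition peak_height (v : X) : R := ip (p v) v.
Definition peak_descent (v : X) : X := - residual ip E V (p v).

Lemma peak_heightE (v u : X) (t : R) : S v -> lspan l u ->
  p v = u + t *: v -> peak_height v = t.
Proof.
case=> _ vL v1 lu pE.
by rewrite /peak_height pE ipDl ipZl (ip_norm hip) v1 ipC vL// expr1n; ring.
Qed.

Lemma peak_decomp (v : X) : S v ->
  lspan l (p v - peak_height v *: v) /\ 0 <= peak_height v.
Proof.
move=> Sv; have [[u [t [lu t0 pE]]] _] := hp Sv.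
by rewrite (peak_heightE Sv lu pE) pE addrK.
Qed.

Lemma peak_space (v : X) : S v -> V (p v).
Proof.
move=> Sv; have [lu _] := peak_decomp Sv; rewrite -(subrK (peak_height v *: v) (p v)).
by apply: fin_dimD => //; [exact: LV|case: Sv => Vv _ _; exact: fin_dimZ].
Qed.

Lemma peak_descent_space (v : X) : V (peak_descent v).
Proof. by apply: fin_dimN => //; have [] := residualP ip E (p v) fV. Qed.

Lemma peak_descentE (v y : X) : V y -> 'd E (p v) y = - ip (peak_descent v) y.
Proof. by move=> Vy; rewrite ipNl opprK; have [_ ->] := residualP ip E (p v) fV. Qed.

Lemma peak_diff0 (v y : X) (e : R) : S v -> 0 < e ->
  (forall h : R, `|h| < e -> half_space (lspan l) v (p v + h *: y)) ->
  'd E (p v) y = 0.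
Proof.
move=> Sv e0 hy; have [_ [del del0 dmax]] := hp Sv.
have y1 : 0 < `|y| + 1 by rewrite ltr_wpDl.
apply: (@diff_local_max _ _ _ hE _ _ (Num.min e (del / (`|y| + 1)))).
  by rewrite lt_min e0 divr_gt0.
move=> h; rewrite lt_min => /andP[he hd]; apply: dmax; first exact: hy.
rewrite addrAC subrr add0r normrZ.
move: hd; rewrite ltr_pdivlMr//; apply: le_lt_trans.
by rewrite ler_wpM2l// lerDl.
Qed.

(** At positive height, p v can be varied in both senses along v and along L without leaving the
    half space, so local maximality makes E' vanish in these directions. *)
Lemma peak_descent_perp (v : X) : S v -> 0 < peak_height v ->
  ip (peak_descent v) v = 0 /\
  forall y, lspan l y -> ip (peak_descent v) y = 0.
Proof.
move=> Sv t0; have [lu _] := peak_decomp Sv.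
have pE := subrK (peak_height v *: v) (p v).
suff z0 y : V y -> 'd E (p v) y = 0 -> ip (peak_descent v) y = 0.
  split=> [|y ly].
    apply: z0; first by case: Sv.
    apply: (peak_diff0 Sv t0) => h hh.
    exists (p v - peak_height v *: v), (peak_height v + h); split => //.
      by move: hh; rewrite ltr_norml => /andP[+ _]; lra.
    by rewrite scalerDl addrA pE.
  apply: z0; first exact: LV.
  apply: (peak_diff0 Sv ltr01) => h _.
  exists (p v - peak_height v *: v + h *: y), (peak_height v); split => //.
  - by apply: lspanD => //; exact: lspanZ.
  - exact: ltW.
  - by rewrite addrAC pE.
by move=> Vy; rewrite (peak_descentE _ Vy) => /eqP; rewrite oppr_eq0 => /eqP.
Qed.

Lemma sphere_path_in (v d : X) (s : R) : S v -> V d -> ip d v = 0 ->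
  (forall y, lspan l y -> ip d y = 0) -> S (sphere_path v d s).
Proof.
case=> Vv vL v1 Vd dv dL; split; last exact: (norm_sphere_path hip).
  by apply: fin_dimZ => //; apply: fin_dimD => //; exact: fin_dimZ.
by move=> y ly; rewrite ipZl ipDl ipZl vL// dL//; ring.
Qed.

Hypothesis cp : {within S, continuous p}.

Lemma cvg_peak_height (v : X) : S v ->
  peak_height y @[y --> within S (nbhs v)] --> peak_height v.
Proof.
move=> Sv; apply: cvg_ip => //; first exact: within_continuous_cvg cp Sv.
exact: cvg_within.
Qed.

(** The difference r of two residuals lies in V, so it can be tested with itself: |r|^2 is the
    difference of the derivatives applied to r, hence at most e |r|. *)
Lemma residual_continuous : continuous (residual ip E V).
Proof.
move=> w; apply/cvgrPdist_le => e e0; near=> z.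
have [Vw rw] := residualP ip E w fV; have [Vz rz] := residualP ip E z fV.
rewrite distrC; set r := residual ip E V z - residual ip E V w.
have [->|r0] := eqVneq r 0; first by rewrite normr0 ltW.
have r_gt0 : 0 < `|r| by rewrite normr_gt0.
rewrite -(ler_pM2r r_gt0) -expr2 -(ip_norm hip) {1}/r ipDl ipNl.
have Vr : V r by exact: fin_dimB.
rewrite rz// rw//; apply: le_trans (ler_norm _) _.
by move: r {r0 r_gt0 Vr}; near: z; exact: C1_near.
Unshelve. all: by end_near. Qed.

Lemma cvg_peak_descent (v : X) : S v ->
  peak_descent y @[y --> within S (nbhs v)] --> peak_descent v.
Proof.
move=> Sv; apply: cvgN.
exact: cvg_comp (within_continuous_cvg cp Sv) (residual_continuous (x := p v)).
Qed.

Local Notation ht := peak_height.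
Local Notation dir := peak_descent.

(* With y = sphere_path v d s', compare p y = t_y y + u_y with its competitor
   (t_y / n') (v + s d) + u_y in the half space of sphere_path v d s: the two differ
   by a multiple of d, so no regularity of p is used beyond continuity. *)
Lemma peak_path_right (v d : X) (s c e : R) :
  S v -> V d -> ip d v = 0 -> (forall y, lspan l y -> ip d y = 0) ->
  0 <= s -> 0 < e ->
  (forall s', s <= s' <= e ->
    forall b, `|b| <= `|ht (sphere_path v d s')| * (e * `|d|) ->
    ht (sphere_path v d s') / `|v + s' *: d| * 'd E (p (sphere_path v d s') + b) d <= c) ->
  exists2 r, 0 < r & forall s', s < s' -> s' < s + r -> s' <= e ->
    E (p (sphere_path v d s')) - E (p (sphere_path v d s)) <= c * (s' - s).
Proof.
move=> Sv Vd dv dL s0 e0 bnd.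
have v1 : `|v| = 1 by case: Sv.
have Sy r : S (sphere_path v d r) by exact: sphere_path_in.
have cP : continuous (fun r => p (sphere_path v d r)).
  exact: (continuous_comp_within cp (sphere_path_continuous hip v1 dv) Sy).
have cH : continuous (fun r => ht (sphere_path v d r)).
  by move=> r; apply: cvg_ip => //; [exact: cP|exact: sphere_path_continuous].
have n0 r : 0 < `|v + r *: d| by exact: sphere_path_norm_gt0.
(* The competitor: v + r d is replaced by v + s d, keeping the L-component and the unnormalised
   coefficient. It is continuous at r = s, where it equals the peak. *)
pose q r := ht (sphere_path v d r) / `|v + r *: d| *: (v + s *: d) +
  (p (sphere_path v d r) - ht (sphere_path v d r) *: sphere_path v d r).
have cq : q r @[r --> s] --> q s.
  have cl : `|v + r *: d| @[r --> s] --> `|v + s *: d|.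
    apply: cvg_norm; apply: cvgD; first exact: cvg_cst.
    by apply: cvgZl; exact: cvg_id.
  apply: cvgD; last first.
    by apply: cvgB; [exact: cP|apply: cvgZ; [exact: cH|exact: sphere_path_continuous]].
  apply: cvgZl; apply: cvgM; first exact: cH.
  by apply: cvgV => //; rewrite gt_eqF.
have qs : q s = p (sphere_path v d s) by rewrite /q -scalerA addrC subrK.
have qH r : half_space (lspan l) (sphere_path v d s) (q r).
  have [lu t0] := peak_decomp (Sy r).
  exists (p (sphere_path v d r) - ht (sphere_path v d r) *: sphere_path v d r).
  exists (ht (sphere_path v d r) / `|v + r *: d| * `|v + s *: d|); split => //.
    by rewrite !mulr_ge0// invr_ge0.
  rewrite [RHS]addrC /q; congr (_ + _); rewrite -[RHS]scalerA; congr (_ *: _).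
  by rewrite /sphere_path scalerA divff ?gt_eqF// scale1r.
have [_ [del del0 dmax]] := hp (Sy s).
have : \forall r \near s, `|q r - q s| < del.
  have /cvgrPdist_lt/(_ _ del0) := cq; apply: filterS => r.
  by rewrite distrC.
rewrite -nbhs_nearE => /nbhs_ballP[r /= r0 rP]; exists r => // s' ss' s'r s'e.
have Eq : E (q s') <= E (p (sphere_path v d s)).
  apply: dmax => //; rewrite -qs; apply: rP.
  by rewrite /ball/= ltr_distlC; apply/andP; split; lra.
apply: le_trans (lerB (lexx _) Eq) _.
pose a := ht (sphere_path v d s') / `|v + s' *: d|.
have pq : p (sphere_path v d s') = q s' + (a * (s' - s)) *: d.
  have -> : q s' = a *: (v + s *: d) + (p (sphere_path v d s') -
      (a *: (v + s *: d) + (a * (s' - s)) *: d)).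
    rewrite /q -/a; congr (_ + (_ - _)).
    by rewrite scalerA -/a -scalerA -scalerDr -addrA -scalerDl [s + _]addrC subrK.
  by rewrite addrAC addrC subrK.
have [th /andP[th0 th1] mv] := mean_value hE (q s') ((a * (s' - s)) *: d).
rewrite {1}pq mv linearZ/=.
rewrite -[leLHS]/(a * (s' - s) * _) mulrAC.
rewrite ler_pM2r ?subr_gt0//.
(* The intermediate point is the peak at s' plus b = (th - 1) a (s' - s) d. As the normalising
   factor is at least 1 and s' - s <= e, this b is in the range covered by [bnd]. *)
have -> : q s' + th *: (a * (s' - s) *: d) =
    p (sphere_path v d s') + (th - 1) *: ((a * (s' - s)) *: d).
  have cancel (x y z : X) : x + y + (z - y) = x + z.
    by rewrite -addrA [y + _]addrC subrK.
  by rewrite pq scalerBl scale1r cancel.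
apply: bnd; first by rewrite (ltW ss').
have a_le : `|a| <= `|ht (sphere_path v d s')|.
  rewrite /a normrM ler_piMr// ger0_norm ?invr_ge0//.
  by rewrite invf_le1// (sphere_path_norm_ge1 hip v1 dv).
have th_le : `|th - 1| <= 1 by rewrite ler_norml; lra.
have s_le : `|s' - s| <= e by rewrite ger0_norm; lra.
clearbody a; rewrite !normrZ !mulrA ler_wpM2r// -[leLHS]mulrA -[leRHS]mul1r.
by apply: ler_pM => //; exact: ler_pM.
Qed.

(** The radius in [peak_path_right] is not uniform in s, so the rate is integrated by applying
    [right_local_decrease] to E(p(v(s))) - c s. *)
Lemma peak_path_decrease (v d : X) (c e : R) :
  S v -> V d -> ip d v = 0 -> (forall y, lspan l y -> ip d y = 0) ->
  0 < e ->
  (forall s : R, 0 <= s <= e ->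
    forall b, `|b| <= `|ht (sphere_path v d s)| * (e * `|d|) ->
    ht (sphere_path v d s) / `|v + s *: d| *
      'd E (p (sphere_path v d s) + b) d <= c) ->
  forall s : R, 0 <= s <= e -> E (p (sphere_path v d s)) - E (p v) <= c * s.
Proof.
move=> Sv Vd dv dL e0 bnd s /andP[s0 se].
have v1 : `|v| = 1 by case: Sv.
have Sy r : S (sphere_path v d r) by exact: sphere_path_in.
pose g r := E (p (sphere_path v d r)) - c * r.
have : g s <= g 0.
  apply: right_local_decrease => //.
    move=> r; apply: cvgB; last by apply: cvgMr; exact: cvg_id.
    apply: (@cvg_comp _ _ _ (fun r => p (sphere_path v d r)) E).
      exact: (continuous_comp_within cp (sphere_path_continuous hip v1 dv) Sy).
    exact: C1_continuous.
  move=> r r0 rs.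
  have [|del del0 delP] := peak_path_right Sv Vd dv dL r0 e0 (c := c).
    by move=> s' /andP[rs' s'e] b; apply: bnd; rewrite s'e (le_trans r0).
  exists del => // s' rs' s'd s's.
  have := delP s' rs' s'd (le_trans s's se); rewrite /g; lra.
by rewrite /g (sphere_path0 _ v1) mulr0 subr0; lra.
Qed.

(** Near v0 the slope of s |-> E(p(v(s))) is close to -T D^2, whereas the step size rule asks for
    about half of this. Continuity keeps the margin for all s up to a threshold independent of v. *)
Lemma peak_descent_uniform (v0 : X) : S v0 -> 0 < ht v0 -> dir v0 != 0 ->
  exists2 e, 0 < e & \forall v \near within S (nbhs v0),
    forall s : R, 0 <= s <= e ->
    E (p (sphere_path v (dir v) s)) - E (p v) <=
      - (1 / 2 * ht v * `|dir v| * `|sphere_path v (dir v) s - v|).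
Proof.
move=> Sv0 t0 d0; pose D := `|dir v0|; pose T := ht v0.
have D0 : 0 < D by rewrite normr_gt0.
have T0 : 0 < T by [].
have k0 : 0 < D / 32 by rewrite divr_gt0.
have /nbhs_ballP[rho /= rho0 rhoP] := C1_near hE (p v0) k0.
have : \forall y \near within S (nbhs v0),
    [/\ `|p y - p v0| < rho / 2, `|dir y - dir v0| < D / 32
       & `|ht y - T| < T / 32].
  near=> y; split; rewrite distrC; near: y.
  - apply: (cvgrPdist_lt _ _).1; last by rewrite divr_gt0.
    exact: within_continuous_cvg.
  - by apply: (cvgrPdist_lt _ _).1 => //; exact: cvg_peak_descent.
  - apply: (cvgrPdist_lt _ _).1; last by rewrite divr_gt0.
    exact: cvg_peak_height.
rewrite near_withinE => /nbhs_ballP[r /= r0 rP].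
(* The three bounds keep, in order, the normalising factor below 33/32, the path within r of v0, and
   the perturbation b within rho / 2. *)
pose e := Num.min (1 / (64 * D)) (Num.min (r / (4 * D)) (rho / (8 * T * D))).
have e0 : 0 < e by rewrite !lt_min !divr_gt0// !mulr_gt0.
have e1 : e * D <= 1 / 64.
  by rewrite -ler_pdivlMr// -mulrA -invfM ge_min lexx.
have e2 : e * D <= r / 4.
  by rewrite -ler_pdivlMr// -mulrA -invfM !ge_min lexx orbT.
have e3 : T * (e * D) <= rho / 8.
  rewrite [leLHS](_ : _ = e * (T * D)); last by ring.
  rewrite -ler_pdivlMr ?mulr_gt0// -mulrA -invfM !ge_min mulrA lexx !orbT//.
clearbody e; exists e => //; rewrite near_withinE.
have r2 : 0 < r / 2 by rewrite divr_gt0.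
have near_v0 : \forall v \near v0, `|v - v0| < r / 2.
  by apply/nbhs_ballP; exists (r / 2) => // v; rewrite distrC -ball_normE.
near=> v => Sv s se.
have vr : `|v - v0| < r / 2 by near: v.
have good y : S y -> `|y - v0| < r -> [/\ `|p y - p v0| < rho / 2,
    `|dir y - dir v0| < D / 32 & `|ht y - T| < T / 32].
  by move=> Sy yr; apply: rP => //; rewrite -ball_normE/= distrC.
have [_ dD tT] : [/\ `|p v - p v0| < rho / 2,
    `|dir v - dir v0| < D / 32 & `|ht v - T| < T / 32].
  by apply: good => //; apply: lt_trans vr _; rewrite ltr_pdivrMr// mulr_natr mulr2n ltrDl.
move: tT; rewrite ltr_distl => /andP[tT1 tT2].
have tv : 0 < ht v by exact: slack_pos tT1.
have v1 : `|v| = 1 by case: Sv.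
have [dv dL] := peak_descent_perp Sv tv.
have Vd : V (dir v) by exact: peak_descent_space.
have dle : `|dir v| <= 33 / 32 * D.
  rewrite -(subrK (dir v0) (dir v)); apply: le_trans (ler_normD _ _) _.
  rewrite [leRHS](_ : _ = D / 32 + D); last by field.
  by rewrite lerD2r ltW.
set d := dir v in dD dv dL Vd dle *.
have Sy s' : S (sphere_path v d s') by exact: sphere_path_in.
have ed : e * `|d| <= 33 / 32 * (e * D).
  by rewrite mulrCA; apply: ler_wpM2l => //; exact: ltW.
(* Here E'(p v0) d = -(dir v0, d), and d is within D / 32 of dir v0. *)
have dEd : 'd E (p v0) d <= - (31 / 32 * D ^+ 2).
  rewrite peak_descentE// lerN2 -(subrK (dir v0) d) ipDr (ip_norm hip).
  apply: slack_inner D0 dD _.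
  have := ip_cauchy_schwarz hip (dir v0) (d - dir v0).
  by rewrite ler_norml => /andP[].
(* The first factor is at least 15/17 T and the derivative at most -14/16 D^2; their product is
   below -3/4 T D^2. *)
have key s' : 0 <= s' <= e ->
    forall b, `|b| <= `|ht (sphere_path v d s')| * (e * `|d|) ->
    ht (sphere_path v d s') / `|v + s' *: d| *
      'd E (p (sphere_path v d s') + b) d <= - (3 / 4 * T * D ^+ 2).
  move=> /andP[s'0 s'e] b bb.
  have s'd : s' * `|d| <= e * `|d| by exact: (ler_wpM2r (normr_ge0 d) s'e).
  have yv0 : `|sphere_path v d s' - v0| < r.
    rewrite -(subrK v (sphere_path v d s')) -addrA.
    apply: le_lt_trans (ler_normD _ _) _.
    exact: slack_radius r0 (sphere_path_dist_le hip v1 dv s'0) s'd ed e2 vr.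
  have [pr _] := good _ (Sy s') yv0.
  rewrite ltr_distl => /andP[ty1 ty2].
  have y0 := slack_pos T0 ty1.
  have br : `|b| < rho / 2.
    move: bb; rewrite gtr0_norm// => bb.
    exact: (slack_segment T0 rho0 (ltW y0)
      (mulr_ge0 (ltW e0) (normr_ge0 d)) ty2 ed e3 bb).
  apply: slack_product T0 _ _.
    apply: slack_height => //; first exact: (sphere_path_norm_ge1 hip v1 dv).
    exact: slack_norm (sphere_path_norm_le d v1 s'0) s'd ed e1.
  apply: slack_slope D0 _ dEd dle.
  have : `|'d E (p (sphere_path v d s') + b) d - 'd E (p v0) d| <= D / 32 * `|d|.
    apply: rhoP; rewrite -ball_normE/= distrC addrAC.
    apply: le_lt_trans (ler_normD _ _) _.
    by rewrite [ltRHS]splitr; exact: ltrD.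
  by rewrite ler_distl => /andP[].
apply: le_trans (peak_path_decrease Sv Vd dv dL e0 key se) _.
rewrite mulNr lerN2.
have [s0 _] := andP se.
have ps := sphere_path_dist_le hip v1 dv s0.
(* The required drop is at most 1/2 (33/32)^3 T D^2 s, less than the 3/4 T D^2 s obtained. *)
exact: (slack_total T0 D0 s0 (ltW tv) (normr_ge0 _) (normr_ge0 _) tT2 dle ps).
Unshelve. all: by end_near. Qed.

Variable lambda : R.
Hypothesis lambda0 : 0 < lambda.

(** The rule [step_admissible] as a condition on v alone, with w and t expressed through the peak
    selection. *)
Definition armijo (v : X) (j : int) : Prop :=
  let v' := sphere_path v (dir v) (lambda / 2 ^ j) in
  `|dir v| < 2 ^ j /\
  E (p v') - E (p v) <= - (1 / 2 * ht v * `|dir v| * `|v' - v|).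

(* Were the step less than half of both thresholds, doubling it would still
   be admissible, contradicting the minimality of the exponent. *)
Lemma armijo_step_lb (v : X) (j : int) (e : R) :
  armijo v j -> (forall j', armijo v j' -> j <= j') ->
  (forall s, 0 <= s <= e ->
    E (p (sphere_path v (dir v) s)) - E (p v) <=
      - (1 / 2 * ht v * `|dir v| * `|sphere_path v (dir v) s - v|)) ->
  Num.min (lambda / 2) (e / 2 * `|dir v|) <= lambda / 2 ^ j * `|dir v|.
Proof.
move=> [dj _] jmin uni; rewrite ge_min.
have p0 : (0 : R) < 2 ^ j by rewrite exprz_gt0.
have pj : (2 : R) ^ (j - 1) = 2 ^ j / 2 by rewrite expfzDr// exprN1.
have l0 : 0 < lambda / 2 ^ j by rewrite divr_gt0.
have lj : lambda / 2 ^ (j - 1) = 2 * (lambda / 2 ^ j).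
  by rewrite pj; field; rewrite gt_eqF.
(* If 2^(j - 1) <= |d|, the bound by lambda / 2 is immediate; otherwise only the energy condition
   can reject j - 1. *)
have [dle|dgt] := leP (2 ^ (j - 1)) (`|dir v|).
  apply/orP; left; rewrite mulrAC ler_pdivlMr// mulrAC -mulrA ler_wpM2l ?(ltW lambda0)//.
  by rewrite -pj.
apply/orP; right; apply: ler_wpM2r => //; rewrite leNgt; apply/negP => slt.
suff /jmin : armijo v (j - 1) by rewrite lerBrDr gerDl.
split => //; rewrite lj; apply: uni; rewrite mulr_ge0 ?(ltW l0)//=.
by move: slt; rewrite ltr_pdivlMr// mulrC => /ltW.
Qed.

(** Near v0 the height and |dir v| exceed half their values at v0, and [armijo_step_lb] bounds s |d|
    below by [c0], so every factor of the guaranteed drop has a positive lower bound. *)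
Lemma armijo_drop (v0 : X) : S v0 -> 0 < ht v0 -> dir v0 != 0 ->
  exists2 c, 0 < c & \forall v \near within S (nbhs v0),
    forall j, armijo v j -> (forall j', armijo v j' -> j <= j') ->
    E (p (sphere_path v (dir v) (lambda / 2 ^ j))) - E (p v) <= - c.
Proof.
move=> Sv0 t0 d0.
have [e e0 uni] := peak_descent_uniform Sv0 t0 d0.
have D0 : 0 < `|dir v0| / 2 by rewrite divr_gt0// normr_gt0.
have T0 : 0 < ht v0 / 2 by rewrite divr_gt0.
pose c0 := Num.min (lambda / 2) (e / 2 * (`|dir v0| / 2)).
have c00 : 0 < c0 by rewrite lt_min divr_gt0// mulr_gt0// divr_gt0.
exists (1 / 2 * (ht v0 / 2) * (`|dir v0| / 2) * (c0 / (1 + c0))).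
  apply: mulr_gt0; last by rewrite divr_gt0// addr_gt0.
  by apply: mulr_gt0 => //; apply: mulr_gt0.
have half (x : R) : 0 < x -> x / 2 < x by lra.
near=> v => j aj jmin.
have Sv : S v by near: v; exact: withinT.
have dv : `|dir v0| / 2 < `|dir v|.
  near: v; apply: (cvgr_gt (`|dir v0|)); last by apply: half; rewrite normr_gt0.
  by apply: cvg_norm; exact: cvg_peak_descent.
have tv : ht v0 / 2 < ht v.
  near: v; apply: (cvgr_gt (ht v0)); last exact: half.
  exact: cvg_peak_height.
have univ : forall s, 0 <= s <= e ->
    E (p (sphere_path v (dir v) s)) - E (p v) <=
      - (1 / 2 * ht v * `|dir v| * `|sphere_path v (dir v) s - v|) by near: v.
have htv : 0 < ht v by exact: lt_trans tv.
have [dperp _] := peak_descent_perp Sv htv.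
have v1 : `|v| = 1 by case: Sv.
have p0 : (0 : R) < 2 ^ j by rewrite exprz_gt0.
have s0 : 0 <= lambda / 2 ^ j by rewrite ltW// divr_gt0.
have [_ drop] := aj; apply: le_trans drop _; rewrite lerN2.
have c_le : c0 <= lambda / 2 ^ j * `|dir v|.
  apply: le_trans (armijo_step_lb aj jmin univ).
  rewrite le_min; apply/andP; split; first by rewrite ge_min lexx.
  apply: (@le_trans _ _ (e / 2 * (`|dir v0| / 2))); first by rewrite ge_min lexx orbT.
  by apply: ler_wpM2l; [rewrite ltW// divr_gt0|exact: ltW].
exact: (drop_lb T0 D0 c00 (ltW tv) (ltW dv) c_le
  (sphere_path_dist_ge hip v1 dperp s0)).
Unshelve. all: by end_near. Qed.

(** If |dir| stayed above e along a subsequence, it would do so at a cluster point v0, whose height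
    is positive thanks to [alpha]. Then [armijo_drop] applies at infinitely many indices. *)
Lemma armijo_iterates_cvg0 (v : nat -> X) (alpha B : R) : 0 < alpha ->
  (forall k, S (v k)) -> (forall k, alpha <= ht (v k)) ->
  (forall k, B <= E (p (v k))) ->
  (forall k, exists j, [/\ armijo (v k) j,
     forall j', armijo (v k) j' -> j <= j' &
     v k.+1 = sphere_path (v k) (dir (v k)) (lambda / 2 ^ j)]) ->
  `|dir (v k)| @[k --> \oo] --> (0 : R).
Proof.
move=> alpha0 Sv tv Bv step.
have decr k : E (p (v k.+1)) <= E (p (v k)).
  have [j [[_ drop] _ ->]] := step k; rewrite -subr_le0.
  apply: le_trans drop _; rewrite oppr_le0 !mulr_ge0//.
  exact: le_trans (ltW alpha0) (tv k).
have mono : nonincreasing_seq (fun k => E (p (v k))).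
  exact/nonincreasing_seqP.
apply/cvgrPdist_lt => e e0; apply: contrapT => /not_near_subseq[f fi fP].
have {}fP i : e <= `|dir (v (f i))|.
  by have /negP := fP i; rewrite -leNgt sub0r normrN normr_id.
have [v0 Sv0 freq] := compact_seq_frequently
  (unit_sphere_perp_compact hip (L := lspan l) fV) (fun i => Sv (f i)).
have pick (P : set X) : (\forall y \near within S (nbhs v0), P y) ->
    forall n, exists2 i, (n <= i)%N & P (v (f i)).
  rewrite near_withinE => nP n.
  by have [i ni /(_ (Sv _)) Pi] := freq _ nP n; exists i.
have d0 : dir v0 != 0.
  apply/eqP => dv0.
  have [|i _] := pick [set y | `|dir y| < e] _ 0%N.
    apply: (cvgr_lt 0) => //.
    have -> : (0 : R) = `|dir v0| by rewrite dv0 normr0.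
    by apply: cvg_norm; exact: cvg_peak_descent.
  by rewrite /= ltNge fP.
have t0 : 0 < ht v0.
  apply: lt_le_trans alpha0 _; rewrite leNgt; apply/negP => t0.
  have [|i _] := pick [set y | ht y < alpha] _ 0%N.
    by apply: (cvgr_lt (ht v0)) => //; exact: cvg_peak_height.
  by rewrite /= ltNge tv.
have [c c0 drop] := armijo_drop Sv0 t0 d0.
have hasinf : has_inf (range (fun k => E (p (v k)))).
  by split; [exists (E (p (v 0%N))), 0%N|exists B => _ [k _ <-]].
(* The energy at K is less than c above the infimum and energies do not increase, so a drop by c at
   an index f i >= K falls below the infimum. *)
have [_ [K _ <-] EK] := inf_adherent c0 hasinf.
have [i Ki dropi] := pick _ drop K.
have [j [aj jmin vE]] := step (f i).
have Kf : (K <= f i)%N by exact: leq_trans Ki (increasing_seq_ge fi i).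
have infE : inf (range (fun k => E (p (v k)))) <= E (p (v (f i).+1)).
  by apply: ge_inf; [case: hasinf|exists (f i).+1].
have := dropi j aj jmin; rewrite -vE lerBlDr => /(le_trans infE).
rewrite addrC -lerBlDr opprK => /(lt_le_trans EK).
by rewrite ltNge (mono _ _ Kf).
Qed.

End Peak.

(** * Invariants of a run of the algorithm *)

Section Run.
Context {R : realType} {X : completeNormedModType R} (ip : {dot X for idfun}).
Hypothesis hip : norm_induced_by ip.
Variable E : X -> R.
Hypothesis hE : C1 E.
Variables (sigma : nat -> R) (eta : nat -> X -> R) (gamma lambda : R) (n : nat).
Variable T : @lmmg_trace R X n.
Hypothesis hrun : lmmg_run ip E sigma eta gamma lambda 0 T.
Variable alpha : nat -> R.

Local Notation reached := (reached ip E sigma eta gamma 0 T).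
Local Notation generated := (generated ip E sigma eta gamma 0 T).

Hypothesis hb : forall N, reached N -> 0 < alpha N /\
  forall k, generated N k -> ((alpha N)%:E <= dist_to (L_ T N) (wi T N k))%E.

Lemma generated_pred (N k : nat) : generated N k.+1 -> generated N k.
Proof. by case=> rN wc; split => // j jk; apply: wc; exact: ltnW. Qed.

(** The component u lies in L and |w - u| = t, so the distance in (b) is at most t. *)
Lemma generated_height (N k : nat) : generated N k -> sphere ip T N (vi T N k) ->
  [/\ wi T N k = peak T N (vi T N k),
      ti T N k = peak_height ip (peak T N) (vi T N k) &
      alpha N <= peak_height ip (peak T N) (vi T N k)].
Proof.
move=> g Sv; have rN := g.1; have [wE wtu Lu t0] := run_w hrun g.
have tE : ti T N k = peak_height ip (peak T N) (vi T N k).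
  by apply/esym/(peak_heightE hip Sv Lu); rewrite -wE wtu addrC.
rewrite -tE; split => //.
have [_ /(_ k g) adist] := hb rN.
rewrite -lee_fin; apply: le_trans adist _.
have -> : (ti T N k)%:E = `|wi T N k - ui T N k|%:E.
  by rewrite wtu addrK normrZ; case: Sv => _ _ ->; rewrite mulr1 ger0_norm.
by apply: ereal_inf_lbound; exists (ui T N k).
Qed.

(** By (b) the height is positive, so the descent direction is orthogonal to v and to L, and the
    normalised update stays on the sphere. *)
Lemma generated_sphere (N k : nat) : generated N k -> sphere ip T N (vi T N k).
Proof.
elim: k => [|k IH] g; first exact: (run_v0 hrun (proj1 g)).
have g' := generated_pred g; have Sv := IH g'; have rN := g.1.
have [wE tE ha] := generated_height g' Sv.
have [j _ ->] := run_step hrun g.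
have fV := run_space hrun rN; have lV i := run_approx hrun i rN.
have hp := run_peak hrun rN.
have t0 : 0 < peak_height ip (peak T N) (vi T N k).
  by apply: lt_le_trans ha; have [] := hb rN.
have [dv dL] := peak_descent_perp hip hE fV lV hp Sv t0.
have := sphere_path_in hip fV (lambda / 2 ^ j) Sv (peak_descent_space ip E _ fV _) dv dL.
by rewrite /sphere_path /v_of /descent_dir /res wE.
Qed.

Lemma generated_armijo (N k : nat) (j : int) : generated N k ->
  step_admissible ip E lambda T N k j =
  armijo ip E (gspace T N) (peak T N) lambda (vi T N k) j.
Proof.
move=> g; have [wE tE _] := generated_height g (generated_sphere g).
by rewrite /step_admissible /armijo /v_of /descent_dir /res wE tE.
Qed.

Lemma generated_step (N k : nat) : generated N k.+1 ->
  exists j, [/\ armijo ip E (gspace T N) (peak T N) lambda (vi T N k) j,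
     forall j', armijo ip E (gspace T N) (peak T N) lambda (vi T N k) j' -> j <= j' &
     vi T N k.+1 = sphere_path (vi T N k)
       (peak_descent ip E (gspace T N) (peak T N) (vi T N k)) (lambda / 2 ^ j)].
Proof.
move=> g; have g' := generated_pred g.
have [j [aj jmin] ->] := run_step hrun g; exists j; split.
- by rewrite -generated_armijo.
- by move=> j'; rewrite -generated_armijo//; exact: jmin.
- have [wE _ _] := generated_height g' (generated_sphere g').
  by rewrite /v_of /descent_dir /res wE.
Qed.

Lemma generated_decrease (N k : nat) : generated N k.+1 ->
  E (wi T N k.+1) <= E (wi T N k).
Proof.
move=> g; have g' := generated_pred g.
have [j [[_ drop] _] vE] := run_step hrun g.
have [wE _ _] := generated_height g (generated_sphere g).
have [_ _ _ t0] := run_w hrun g'.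
rewrite wE vE -subr_le0; apply: le_trans drop _.
by rewrite oppr_le0 !mulr_ge0.
Qed.

Lemma generated_nonincreasing (N k : nat) : generated N k ->
  E (wi T N k) <= E (wi T N 0).
Proof.
elim: k => // k IH g; apply: le_trans (generated_decrease g) (IH _).
exact: generated_pred.
Qed.

Lemma generated_space (N k : nat) : generated N k -> gspace T N (wi T N k).
Proof.
move=> g; have rN := g.1; have fV := run_space hrun rN.
have [wE _ _] := generated_height g (generated_sphere g).
have lV i := run_approx hrun i rN; rewrite wE.
exact: (peak_space hip fV lV (run_peak hrun rN) (generated_sphere g)).
Qed.

Lemma generated_lower_bound :
  (-oo < ereal_inf [set ereal_inf [set (E (peak T N v))%:E | v in sphere ip T N]
    | N in reached])%E ->
  exists B, forall N k, generated N k -> B <= E (wi T N k).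
Proof.
set I := ereal_inf _ => I0.
have Ile N k : generated N k -> (I <= (E (wi T N k))%:E)%E.
  move=> g; have [wE _ _] := generated_height g (generated_sphere g).
  apply: ge_ereal_inf.
  exists (ereal_inf [set (E (peak T N v))%:E | v in sphere ip T N]).
    by exists N => //; exact: g.1.
  apply: ereal_inf_lbound; exists (vi T N k); first exact: generated_sphere.
  by rewrite wE.
(* An infimum +oo would mean that nothing is generated, so any bound serves; -oo is excluded by
   (c). *)
case: I I0 Ile => [B _|_|]; last by rewrite ltxx.
  by move=> Ile; exists B => N k g; rewrite -lee_fin; exact: Ile.
by move=> Ile; exists 0 => N k /Ile.
Qed.

Hypothesis hlambda : 0 < lambda.

Lemma nonterminating_residual_cvg0 (N : nat) : reached N ->
  {within sphere ip T N, continuous (peak T N)} ->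
  (exists B, forall k, generated N k -> B <= E (wi T N k)) ->
  (forall k, while_cond ip E sigma eta gamma T N k) ->
  `|residual ip E (gspace T N) (wi T N k)| @[k --> \oo] --> (0 : R).
Proof.
move=> rN cp [B EB] wc; have g k : generated N k by split.
have hw k := generated_height (g k) (generated_sphere (g k)).
under eq_fun => k do [have [-> _ _] := hw k; rewrite -normrN].
have fV := run_space hrun rN; have lV i := run_approx hrun i rN.
apply: (armijo_iterates_cvg0 hip hE fV lV (run_peak hrun rN) cp hlambda
  (alpha := alpha N) (B := B)).
- by have [] := hb rN.
- by move=> k; exact: generated_sphere.
- by move=> k; have [] := hw k.
- by move=> k; have [<- _ _] := hw k; exact: EB.
- by move=> k; exact: generated_step.
Qed.

End Run.

Lemma bounded_fun_between (R : realType) (a : nat -> R) (b c : R) :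
  (forall k, b <= a k <= c) -> bounded_fun a.
Proof.
move=> abc; exists (`|b| + `|c|); split; first exact: num_real.
move=> M bcM k _ /=; apply: le_trans (ltW bcM).
have /andP[bk kc] := abc k.
have /andP[b1 _] : - `|b| <= b <= `|b| by rewrite -ler_norml.
have /andP[_ c1] : - `|c| <= c <= `|c| by rewrite -ler_norml.
have b0 := normr_ge0 b; have c0 := normr_ge0 c.
by rewrite ler_norml; lra.
Qed.

Lemma norm_le_cvg0 (R : realType) (a b : nat -> R) :
  (\forall i \near \oo, `|a i| <= b i) -> b @ \oo --> (0 : R) ->
  a @ \oo --> (0 : R).
Proof.
move=> ab b0; apply/norm_cvg0P; apply: squeeze_cvgr (cvg_cst 0) b0.
by apply: filterS ab => i abi; rewrite normr_ge0.
Qed.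

(** * Dual limits of E' along dense Galerkin spaces *)

Section DualLimit.
Context {R : realType} {X : completeNormedModType R} (ip : {dot X for idfun}).
Hypothesis hip : norm_induced_by ip.
Variables (E : X -> R) (V : nat -> set X) (x : nat -> X) (sigma : nat -> R).
Hypothesis hE : C1 E.
Hypothesis fV : forall N, finite_dim_subspace (V N).
Hypothesis V_nested : forall N, V N `<=` V N.+1.
Hypothesis V_dense : closure (\bigcup_N V N) = setT.
Hypothesis sigma0 : sigma @ \oo --> (0 : R).
Hypothesis res_le : forall N, `|residual ip E (V N) (x N)| <= sigma N.

Lemma dual_limit_eq0 (f : nat -> nat) (phi : {linear X -> R}) :
  increasing_seq f -> continuous phi ->
  dual_cvg (fun i => 'd E (x (f i))) phi -> forall y, phi y = 0.
Proof.
move=> fi cphi dphi.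
have mono M N : (M <= N)%N -> V M `<=` V N.
  move=> /subnKC <-; elim: (N - M)%N => [|k IH]; first by rewrite addn0.
  by rewrite addnS => y /IH; exact: V_nested.
have phi0 M y : V M y -> phi y = 0.
  move=> VMy.
  have dEy : 'd E (x (f i)) y @[i --> \oo] --> (0 : R).
    apply: (@norm_le_cvg0 _ _ (fun i => sigma (f i) * `|y|)).
    - near=> i.
      (* Nestedness makes y a test vector for the residual on V (f i) once i >= M, since f i >=
         i. *)
      have Vy : V (f i) y.
        apply: (mono M) => //; apply: leq_trans (increasing_seq_ge fi i).
        by near: i; exists M.
      have [_ <-//] := residualP ip E (x (f i)) (fV (f i)).
      apply: le_trans (ip_cauchy_schwarz hip _ _) _.
      exact: ler_wpM2r.
    - rewrite -[X in _ --> X](mul0r `|y|); apply: cvgMl.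
      exact: cvg_comp (increasing_seq_cvg fi) sigma0.
  have dEphi : 'd E (x (f i)) y - phi y @[i --> \oo] --> (0 : R).
    apply: (@norm_le_cvg0 _ _ (fun i => dual_norm (fun z => 'd E (x (f i)) z - phi z) * `|y|)).
    - near=> i.
      by apply: dual_norm_sub_bound => //; exact: C1_diff_continuous.
    - by rewrite -[X in _ --> X](mul0r `|y|); apply: cvgMl.
  have h : (fun=> phi y) @ \oo --> (0 : R).
    have -> : (fun=> phi y) =
        (fun i => 'd E (x (f i)) y - ('d E (x (f i)) y - phi y)).
      by apply/funext => i; rewrite opprB addrC subrK.
    by rewrite -[X in _ --> X](subrr (0 : R)); exact: cvgB.
  exact: (cvg_unique (@norm_hausdorff _ _) (cvg_cst (phi y)) h).
have closed0 : closed [set y | phi y = 0].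
  by apply: (@closed_comp _ _ phi [set 0]) => [y _|]; [exact: cphi|exact: closed_eq].
have sub : \bigcup_N V N `<=` [set y | phi y = 0] by move=> z [N _ /phi0].
by move=> y; apply: closed0; apply: closure_subset sub _ _; rewrite V_dense.
Unshelve. all: by end_near. Qed.

End DualLimit.

(** * The two convergence statements *)

Theorem theorem3p2 (R : realType) (X : completeNormedModType R)
    (ip : {dot X for idfun}) (hip : norm_induced_by ip)
    (E : X -> R) (hE : C1 E) (hPS : palais_smale E)
    (sigma : nat -> R) (hsigma : forall N, 0 < sigma N)
    (hsigma0 : sigma @ \oo --> (0 : R))
    (gamma lambda : R) (hgamma : 0 < gamma) (hlambda : 0 < lambda)
    (n : nat) (hn : (0 < n)%N)
    (wprev : 'I_n.-1 -> X) (hwprev : lmmg_input E wprev)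
    (eta : nat -> X -> R) (T : @lmmg_trace R X n)
    (hrun : lmmg_run ip E sigma eta gamma lambda 0 T)
    (C : R) (hC : 0 < C)
    (heta : error_indicator ip E sigma eta gamma 0 T C)
    (* (a) *)
    (ha : forall N, reached ip E sigma eta gamma 0 T N ->
       {within sphere ip T N, continuous (peak T N)})
    (* (b) *)
    (alpha : nat -> R)
    (hb : forall N, reached ip E sigma eta gamma 0 T N ->
       0 < alpha N /\
       forall k, generated ip E sigma eta gamma 0 T N k ->
         ((alpha N)%:E <= dist_to (L_ T N) (wi T N k))%E)
    (* (c) *)
    (hc : (-oo < ereal_inf
       [set ereal_inf [set (E (peak T N v))%:E | v in sphere ip T N]
         | N in reached ip E sigma eta gamma 0 T])%E) :
  (* (I) *)
  (forall N, reached ip E sigma eta gamma 0 T N ->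
     (forall k, while_cond ip E sigma eta gamma T N k) ->
     derivative_continuous_on E (gspace T N) ->
     dist_to (critical_points E) (wi T N k) @[k --> \oo] --> 0%:E)
  /\
  (* (II) *)
  (forall kstar : nat -> nat,
     (forall N, generated ip E sigma eta gamma 0 T N (kstar N) /\
        `|residual ip E (gspace T N) (wi T N (kstar N))| <=
          Num.min (gamma * eta N (wi T N (kstar N))) (sigma N)) ->
     closure (\bigcup_N gspace T N) = setT ->
     (forall J : set nat, infinite_set J ->
        has_dual_cvg_subseq (fun N => 'd E (wi T N (kstar N))) J) ->
     dist_to (critical_points E) (wi T N (kstar N)) @[N --> \oo] --> 0%:E).
Proof.
have [B EB] := generated_lower_bound hip hE hrun hb hc.
have dle N k : generated ip E sigma eta gamma 0 T N k ->
    0 <= dual_norm ('d E (wi T N k)) <= C * eta N (wi T N k).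
  move=> g; have [_ dC] := heta N _ g.1 (generated_space hip hE hrun hb g).
  by rewrite dC dual_norm_ge0//; exact: C1_diff_continuous.
split.
  move=> N rN wc _; have g k : generated ip E sigma eta gamma 0 T N k by split.
  have r0 := nonterminating_residual_cvg0 hip hE hrun hb hlambda rN (ha N rN)
    (ex_intro _ B (fun k g => EB N k g)) wc.
  have du : dual_norm ('d E (wi T N k)) @[k --> \oo] --> (0 : R).
    apply: (@norm_le_cvg0 _ _ (fun k =>
      C / gamma * `|residual ip E (gspace T N) (wi T N k)|)); last first.
      by rewrite -[X in _ --> X](mulr0 (C / gamma)); exact: cvgMr.
    (* Eventually the [sigma N] disjunct of the loop condition fails, and the other one bounds [eta]
       by the residual. *)
    have : \forall k \near \oo,
        `|residual ip E (gspace T N) (wi T N k)| < sigma N.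
      exact: (cvgr_lt 0).
    apply: filterS => k rk; have /andP[d0 dC] := dle N k (g k).
    rewrite ger0_norm//; apply: le_trans dC _.
    rewrite -mulrA; apply: ler_wpM2l; first exact: ltW.
    rewrite mulrC ler_pdivlMr// mulrC.
    by have /orP[/ltW//|] := wc k; rewrite /res ltNge (ltW rk).
  apply: dist_to_cvg0 => J /infinite_subseq[f fi Jf].
  have [||h [a ca wa]] := palais_smale_subseq hE hPS (u := fun k => wi T N (f k)).
  - apply: (@bounded_fun_between _ _ B (E (wi T N 0))) => k.
    by rewrite EB// (generated_nonincreasing hip hE hrun hb (g (f k))).
  - exact: cvg_comp (increasing_seq_cvg fi) du.
  - by exists (f \o h), a => //; split => // i; exact: Jf.
move=> kstar hk dense hsub.
pose x N := wi T N (kstar N).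
have g N : generated ip E sigma eta gamma 0 T N (kstar N) := (hk N).1.
have rN N : reached ip E sigma eta gamma 0 T N := (g N).1.
(* The stopping criterion negates both disjuncts of the loop condition, so kstar N is the end of the
   inner loop, as [run_enrich] requires. *)
have ends N : loop_ends_at ip E sigma eta gamma T N (kstar N).
  split; first exact: (g N).2.
  have := (hk N).2; rewrite le_min => /andP[h1 h2].
  by rewrite /while_cond negb_or -!leNgt; apply/andP.
have fV N := run_space hrun (rN N).
have nested N : gspace T N `<=` gspace T N.+1.
  by have [] := run_enrich hrun (rN N.+1) (ends N).
have res_le N : `|residual ip E (gspace T N) (x N)| <= sigma N.
  by have := (hk N).2; rewrite le_min => /andP[].
(* The final iterate on one space is the initial one on the next, so the decrease within each space
   chains across spaces. *)
have Edecr : nonincreasing_seq (fun N => E (x N)).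
  apply/nonincreasing_seqP => N; rewrite /x.
  have [_ <- _] := run_enrich hrun (rN N.+1) (ends N).
  exact: (generated_nonincreasing hip hE hrun hb (g N.+1)).
apply: dist_to_cvg0 => J /hsub[f [fi Jf [phi cphi dphi]]].
have phi0 := dual_limit_eq0 hip hE fV nested dense hsigma0 res_le fi cphi dphi.
have [||h [a ca xa]] := palais_smale_subseq hE hPS (u := fun i => x (f i)).
- apply: (@bounded_fun_between _ _ B (E (x 0%N))) => k.
  by rewrite EB//; exact: Edecr.
- move: dphi; rewrite /dual_cvg; under eq_fun do under eq_fun do rewrite phi0 subr0.
  exact.
- by exists (f \o h), a => //; split => // i; exact: Jf.
Qed.
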